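(* Let $f:\bar{\mathbb C}\to\bar{\mathbb C}$ be a rational map of degree at least $2$ with $\infty$ a critical point. Given $\hat z\in\mathcal A^{\mathbf n}_f$, there exists a sequence of similarities $A_n(w)=\alpha_nw+\beta_n$ ($\alpha_n\in\mathbb C\setminus\{0\}$, $\beta_n\in\mathbb C$) such that the maps $$\phi_n=A_n\circ\pi\circ\hat f^{-n}:L(\hat z)\to\bar{\mathbb C}$$ converge, uniformly on compact sets, to a conformal isomorphism $\phi:L(\hat z)\to\mathbb C$.
   Context: $\mathcal N_f$ is the space of backward orbits $\hat z=(z_0,z_{-1},\dots)$, $f(z_{-(n+1)})=z_{-n}$, with the topology induced by the product topology; $\pi_{-n}(\hat z)=z_{-n}$, $\pi=\pi_0$, and $\hat f(\hat z)=(f(z_0),z_0,z_{-1},\dots)$, so that $\pi\circ\hat f^{-n}=\pi_{-n}$. $\hat z$ is regular if $z_0$ has a neighborhood $U$ such that, with $U_{-n}$ the component of $f^{-n}(U)$ containing $z_{-n}$, the maps $f:U_{-(n+1)}\to U_{-n}$ are univalent for all sufficiently large $n$. $\mathcal R_f$ is the set of regular points; its leaves are its path components, which are Riemann surfaces with intrinsic basic neighborhoods $\hat U=\{\hat\zeta:\zeta_{-n}\in U_{-n}\ \forall n\}$ (where $\hat z$ is a point of the leaf, $U$ is a neighborhood of $z_0$, and $U_{-n}$ is the component of $f^{-n}(U)$ containing $z_{-n}$, with $f:U_{-(n+1)}\to U_{-n}$ univalent for all sufficiently large $n$) and charts $\pi_{-N}$, $N$ large. $L(\hat z)$ is the leaf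 containing $\hat z$. $\mathcal A^{\mathbf n}_f\subset\mathcal R_f$ is the union of the leaves conformally equivalent to $\mathbb C$. On each compact subset of $L(\hat z)$ the maps $\phi_n$ take finite values for all sufficiently large $n$, and uniform convergence is understood for such $n$. *)

(* Defs.v *)
From HB Require Import structures.
From mathcomp Require Import all_boot all_order all_algebra complex.
From mathcomp Require Import all_classical all_reals all_analysis.

Set Implicit Arguments.
Unset Strict Implicit.
Unset Printing Implicit Defensive.

Import Order.TTheory GRing.Theory Num.Theory.
Import numFieldNormedType.Exports.

Local Open Scope classical_set_scope.
Local Open Scope ring_scope.

(* Keeping the type at numClosedFieldType gives it the topology and the
   normed-module-over-itself structure of a numFieldType, rather than the
   R-vector space structure declared on R[i] in real_closed. *)
Definition cplx (R : realType) : numClosedFieldType := R[i]%C.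

Definition sphere (R : realType) := one_point_compactification (cplx R).

Section Sphere.
Variable R : realType.
Local Notation C := (cplx R).
Local Notation S := (sphere R).

Definition infty : S := None.

(* Value 0 at infinity is a convention; since 0^-1 = 0, it also makes
   z |-> (finite_part z)^-1 the coordinate 1/z around infinity. *)
Definition finite_part (z : S) : C := odflt 0 z.

(* w |-> a w + b, extended by fixing infinity *)
Definition similarity (a b : C) (z : S) : S := omap (fun w => a * w + b) z.

(* Standard coordinate around c (z at a finite c, 1/z at infinity), and its
   inverse.  The coordinate takes a junk value at the one point of the sphere
   not in its domain. *)
Definition sphere_coord (c : S) : S -> C :=
  if c is Some _ then finite_part else fun z => (finite_part z)^-1.

Definition sphere_coord_inv (c : S) : C -> S :=
  if c is Some _ then Some else fun w => if w == 0 then infty else Some w^-1.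

Definition local_rep (g : S -> S) (c : S) : C -> C :=
  sphere_coord (g c) \o g \o sphere_coord_inv c.

(* Complex differentiability at c; continuity makes g map a neighbourhood of
   c into the domain of the coordinate at g c. *)
Definition complex_diff_at (g : S -> S) (c : S) : Prop :=
  {for c, continuous g} /\ derivable (local_rep g c) (sphere_coord c c) 1.

Definition critical_point (g : S -> S) (c : S) : Prop :=
  is_derive (sphere_coord c c) 1 (local_rep g c) 0.

(* p / q as a self-map of the sphere, for coprime p and q *)
Definition ratval (p q : {poly C}) (z : S) : S :=
  match z with
  | Some w => if q.[w] == 0 then infty else Some (p.[w] / q.[w])
  | None => let d := (maxn (size p) (size q)).-1 in
            if q`_d == 0 then infty else Some (p`_d / q`_d)
  end.

Definition rational_map (f : S -> S) (d : nat) : Prop :=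
  exists p q : {poly C},
    [/\ coprimep p q, (maxn (size p) (size q)).-1 = d & f = ratval p q].

(* Riemann surfaces, with charts valued in the sphere: an atlas on T is a set
   of pairs (domain, chart). *)
Definition atlas (T : Type) := set (set T * (T -> S)).

Definition plane_atlas : atlas C := [set ([set: C], Some : C -> S)].

(* h is holomorphic at each point of the open set X *)
Definition holomorphic_on (T T' : topologicalType) (A : atlas T)
    (B : atlas T') (X : set T) (h : T -> T') : Prop :=
  forall x, X x -> {for x, continuous h} /\
    forall D chi E kappa, A (D, chi) -> B (E, kappa) -> D x -> E (h x) ->
      exists g : S -> S, complex_diff_at g (chi x) /\
        \forall y \near x, kappa (h y) = g (chi y).

Definition conformal_iso (T T' : topologicalType) (A : atlas T)
    (B : atlas T') (X : set T) (Y : set T') (phi : T -> T') : Prop :=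
  exists psi : T' -> T,
    [/\ (forall x, X x -> Y (phi x)) /\ (forall y, Y y -> X (psi y)),
        (forall x, X x -> psi (phi x) = x),
        (forall y, Y y -> phi (psi y) = y),
        holomorphic_on A B X phi &
        holomorphic_on B A Y psi].

End Sphere.

Arguments plane_atlas R : clear implicits.

Section NaturalExtension.
Variables (R : realType) (f : sphere R -> sphere R).
Local Notation C := (cplx R).
Local Notation S := (sphere R).

(* A backward orbit is indexed so that z n is the coordinate z_{-n};
   {ptws nat -> S} carries the product topology. *)
Definition natural_extension : set {ptws nat -> S} :=
  [set z | forall n, f (z n.+1) = z n].

Definition fhat (z : nat -> S) : nat -> S :=
  fun n => if n is m.+1 then z m else f (z 0%N).

Definition fhat_inv (z : nat -> S) : nat -> S := fun n => z n.+1.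

Lemma fhat_natural_extension z :
  natural_extension z -> natural_extension (fhat z).
Proof. by move=> zN [|n] //=; exact: zN. Qed.

Lemma fhat_inv_natural_extension z :
  natural_extension z -> natural_extension (fhat_inv z).
Proof. by move=> zN n; exact: zN. Qed.

Lemma fhatK z : fhat_inv (fhat z) = z.
Proof. by []. Qed.

Lemma fhat_invK z : natural_extension z -> fhat (fhat_inv z) = z.
Proof. by move=> zN; apply/funext => -[|n] //=; exact: zN. Qed.

Lemma iter_fhat_inv n (z : nat -> S) : iter n fhat_inv z 0%N = z n.
Proof.
suff H m : iter n fhat_inv z m = z (m + n)%N by rewrite H.
elim: n m => [|n IHn] m /=; first by rewrite addn0.
by rewrite /fhat_inv IHn addSnnS.
Qed.

(* U_{-n} *)
Definition pullback (U : set S) (z : nat -> S) (n : nat) : set S :=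
  connected_component (iter n f @^-1` U) (z n).

(* f is holomorphic, so its restriction to U_{-(n+1)} is univalent iff it is
   injective. *)
Definition univalent_from (U : set S) (z : nat -> S) (N : nat) : Prop :=
  forall n, (N <= n)%N -> set_inj (pullback U z n.+1) f.

Definition regular_at (z : nat -> S) : Prop :=
  exists U, open_nbhs (z 0%N) U /\ exists N, univalent_from U z N.

Definition regular_set : set {ptws nat -> S} :=
  [set z | natural_extension z /\ regular_at z].

(* Same points as regular_set, which as a type (set_type) has the topology
   induced by the product topology; leaf_space is given instead the intrinsic
   topology of the leaves. *)
Definition leaf_space := set_type regular_set.

Definition orbit_of (x : leaf_space) : nat -> S := set_val x.

Definition basic_nbhd (U : set S) (z : nat -> S) : set leaf_space :=
  [set y | forall n, pullback U z n (orbit_of y n)].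

Definition leaf_open (O : set leaf_space) : Prop :=
  forall x, O x -> exists U, [/\ open_nbhs (orbit_of x 0%N) U,
    exists N, univalent_from U (orbit_of x) N &
    basic_nbhd U (orbit_of x) `<=` O].

Lemma pullbackS (U V : set S) z n :
  U `<=` V -> pullback U z n `<=` pullback V z n.
Proof.
move=> UV y [A [Az AU Ac] Ay]; exists A => //; split=> // w /AU.
exact: UV.
Qed.

Lemma leaf_openT : leaf_open setT.
Proof.
move=> x _; have [_ [U [zU UN]]] : regular_set (set_val x) by exact: set_valP.
by exists U.
Qed.

Lemma leaf_openI : setI_closed leaf_open.
Proof.
move=> O O' oO oO' x [Ox O'x].
have [U [zU [N UN] UO]] := oO x Ox; have [V [zV _ VO]] := oO' x O'x.
exists (U `&` V); split; first exact: open_nbhsI.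
- exists N => n Nn a b /set_mem Ua /set_mem Ub.
  apply: (UN n Nn); apply/mem_set.
    by apply: pullbackS Ua => ? [].
  by apply: pullbackS Ub => ? [].
- move=> y yUV; split.
    by apply: UO => n; apply: pullbackS (yUV n) => ? [].
  by apply: VO => n; apply: pullbackS (yUV n) => ? [].
Qed.

Lemma leaf_open_bigU (I : Type) (F : I -> set leaf_space) :
  (forall i, leaf_open (F i)) -> leaf_open (\bigcup_i F i).
Proof.
move=> oF x [i _ Fix]; have [U [zU UN UF]] := oF i x Fix.
by exists U; split=> // y /UF ?; exists i.
Qed.

HB.instance Definition _ := Choice.on leaf_space.
HB.instance Definition _ :=
  isOpenTopological.Build leaf_space leaf_openT leaf_openI leaf_open_bigU.

(* Path component of regular_set for the topology induced by the product
   topology. *)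
Definition leaf (x : leaf_space) : set leaf_space :=
  [set y | exists gamma : R -> set_type regular_set,
    [/\ {within `[0, 1], continuous gamma}, gamma 0 = x & gamma 1 = y]].

Definition leaf_atlas : atlas R leaf_space :=
  [set c | exists (x : leaf_space) (U : set S) (N : nat),
    [/\ open_nbhs (orbit_of x 0%N) U, univalent_from U (orbit_of x) N,
        c.1 = basic_nbhd U (orbit_of x) & c.2 = fun y => orbit_of y N]].

Definition affine_part : set leaf_space :=
  [set x | exists phi : leaf_space -> C,
    conformal_iso leaf_atlas (plane_atlas R) (leaf x) [set: C] phi].

End NaturalExtension.

Arguments fhat_inv {R} z.
Arguments leaf_atlas {R} f.

(* Main.v *)
Require Import Defs.
From mathcomp Require Import all_boot all_order all_algebra.
From mathcomp Require Import all_classical all_reals all_analysis.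
From mathcomp Require Import complex ring lra.
Import Order.TTheory GRing.Theory Num.Theory.
Import numFieldNormedType.Exports.
Local Open Scope classical_set_scope.
Local Open Scope ring_scope.

(** Fix a conformal isomorphism [phi] from the leaf onto the plane, with inverse
    [psi], and read the backward projections along it: [proj psi n] is the
    sphere-valued function sending [v] to the [n]-th coordinate of the orbit
    [psi v].  The theorem holds with this very [phi], normalised by the affine
    maps that send the values of [proj psi n] at 0 and 1 to 0 and 1.  Two facts
    are behind it.

    On every square, [proj psi n] is finite and injective for large [n], with
    non-vanishing derivative ([proj_box]).  Each point of the leaf has a
    neighbourhood on which all late projections are charts, so that they are
    injective there and their derivatives do not vanish ([proj_sderiv]).  A late
    projection cannot pass through infinity: [f] sends projection [n+1] to
    projection [n], hence the latter would have derivative 0, infinity being a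
    critical point ([proj_finite]).  Two distinct points of the leaf are
    separated by some projection and then by all later ones; compactness of the
    product of the square with itself makes all this uniform.

    A univalent function [g] on a huge square, fixing 0 and 1, is close to the
    identity on a smaller square ([univalent_rigidity]).  This is a weak form of
    Koebe's distortion theorem.  With [a] the value of least modulus on the
    boundary, [1 - g / a] has a holomorphic square root [h] on the half-size
    square.  The values of [h] fill a disc around 1 and, [g] being injective, [h]
    then omits the opposite disc around -1.  Hence [1 / (h + 1)] is bounded, its
    variation near 0 is controlled by Schwarz's lemma, and this bounds
    [g v / v] by an absolute constant.  The maximum principle applied to
    [(g v / v - 1) / (v - 1)], which is small on the boundary of a large square,
    concludes.

    The only complex analysis needed is the maximum principle on squares
    ([max_principle]), for functions that are merely complex differentiable, with
    two exceptional points of continuity.  Contour integrals are replaced by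
    midpoint sums over dyadic subdivisions of the boundary ([boundary_sum]): these
    are exactly additive when a square is cut in four, so Goursat's bisection
    applies to them directly ([goursat]).  Applied to
    [(f v - f w) ^+ 2 / (v - w)], which is differentiable even at [w], Goursat
    bounds [f w] by a constant times the maximum of [f] on the boundary; applying
    this to powers of [f] removes the constant. *)

Set Implicit Arguments.
Unset Strict Implicit.
Unset Printing Implicit Defensive.

(** * The plane and complex differentiability *)

Section Plane.
Variable R : realType.
Local Notation C := (cplx R).

(** The modulus with values in [R]: the library norm on [cplx R] takes values
    in [cplx R] itself, whose order is only partial. *)
Definition cabs (z : C) : R := Normc.normc z.
Definition re (z : C) : R := complex.Re z.
Definition im (z : C) : R := complex.Im z.
Definition ofR (x : R) : C := real_complex R x.
Definition iC : C := Complex 0 1.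

Lemma normE (z : C) : `|z| = ofR (cabs z).
Proof. by case: z. Qed.

Lemma cabsM (x y : C) : cabs (x * y) = cabs x * cabs y.
Proof. exact: Normc.normcM. Qed.

Lemma cabsV (x : C) : cabs x^-1 = (cabs x)^-1.
Proof. exact: Normc.normcV. Qed.

Lemma cabs_ge0 (x : C) : 0 <= cabs x.
Proof. by case: x => a b; exact: sqrtr_ge0. Qed.

Lemma cabs0 : cabs 0 = 0. Proof. exact: Normc.normc0. Qed.
Lemma cabs1 : cabs 1 = 1. Proof. exact: Normc.normc1. Qed.

Lemma cabs_eq0 (x : C) : (cabs x == 0) = (x == 0).
Proof.
apply/eqP/eqP => [/Normc.eq0_normc//|->]; exact: cabs0.
Qed.

Lemma cabs_gt0 (x : C) : (0 < cabs x) = (x != 0).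
Proof. by rewrite lt0r cabs_ge0 andbT cabs_eq0. Qed.

Lemma cabsX (x : C) n : cabs (x ^+ n) = cabs x ^+ n.
Proof. by elim: n => [|n IH]; rewrite ?expr0 ?cabs1// !exprS cabsM IH. Qed.

Lemma ler_cabsD (x y : C) : cabs (x + y) <= cabs x + cabs y.
Proof. exact: le_normcD. Qed.

Lemma cabsN (x : C) : cabs (- x) = cabs x.
Proof. exact: normcN. Qed.

Lemma cabsB (x y : C) : cabs (x - y) = cabs (y - x).
Proof. by rewrite -cabsN opprB. Qed.

Lemma ler_cabsB (x y : C) : cabs (x - y) <= cabs x + cabs y.
Proof. by rewrite -(cabsN y); exact: ler_cabsD. Qed.

Lemma lerB_cabs (x y : C) : cabs x - cabs y <= cabs (x + y).
Proof.
by rewrite lerBlDr -[X in cabs X <= _](addrK y) (le_trans (ler_cabsB _ _)).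
Qed.

Lemma cabs_ofR (x : R) : cabs (ofR x) = `|x|.
Proof. by rewrite /cabs /= expr0n /= addr0 sqrtr_sqr. Qed.

Lemma cabs_iC : cabs iC = 1.
Proof. by rewrite /cabs /= expr0n /= add0r expr1n sqrtr1. Qed.

Lemma reD (x y : C) : re (x + y) = re x + re y.
Proof. by case: x; case: y. Qed.
Lemma imD (x y : C) : im (x + y) = im x + im y.
Proof. by case: x; case: y. Qed.
Lemma reN (x : C) : re (- x) = - re x.
Proof. by case: x. Qed.
Lemma imN (x : C) : im (- x) = - im x.
Proof. by case: x. Qed.
Lemma reM (x y : C) : re (x * y) = re x * re y - im x * im y.
Proof. by case: x; case: y. Qed.
Lemma imM (x y : C) : im (x * y) = re x * im y + im x * re y.
Proof. by case: x; case: y. Qed.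
Lemma re_ofR x : re (ofR x) = x. Proof. by []. Qed.
Lemma im_ofR x : im (ofR x) = 0. Proof. by []. Qed.
Lemma re_iC : re iC = 0. Proof. by []. Qed.
Lemma im_iC : im iC = 1. Proof. by []. Qed.
Lemma re0 : re 0 = 0. Proof. by []. Qed.
Lemma im0 : im 0 = 0. Proof. by []. Qed.
Lemma re1 : re 1 = 1. Proof. by []. Qed.
Lemma im1 : im 1 = 0. Proof. by []. Qed.
Definition ReIm := (reD, imD, reN, imN, reM, imM, re_ofR, im_ofR, re_iC, im_iC,
  re0, im0, re1, im1).

Lemma ofRD : {morph ofR : x y / x + y}. Proof. exact: rmorphD. Qed.
Lemma ofRN : {morph ofR : x / - x}. Proof. exact: rmorphN. Qed.

Lemma cplx_eq (x y : C) : re x = re y -> im x = im y -> x = y.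
Proof. by case: x => a b; case: y => c d /= -> ->. Qed.

Lemma cabs_sqr (x : C) : cabs x ^+ 2 = re x ^+ 2 + im x ^+ 2.
Proof. by case: x => a b; rewrite /cabs /= sqr_sqrtr// addr_ge0// sqr_ge0. Qed.

Lemma ler_re (x : C) : `|re x| <= cabs x.
Proof.
rewrite -(@ler_pXn2r _ 2)// ?nnegrE ?cabs_ge0//.
by rewrite real_normK ?num_real// cabs_sqr lerDl sqr_ge0.
Qed.

Lemma ler_im (x : C) : `|im x| <= cabs x.
Proof.
rewrite -(@ler_pXn2r _ 2)// ?nnegrE ?cabs_ge0//.
by rewrite real_normK ?num_real// cabs_sqr lerDr sqr_ge0.
Qed.

Lemma ler_reim (x : C) : cabs x <= `|re x| + `|im x|.
Proof.
have -> : x = ofR (re x) + iC * ofR (im x).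
  by apply: cplx_eq; rewrite !ReIm; ring.
by rewrite (le_trans (ler_cabsD _ _))// cabsM cabs_iC mul1r !cabs_ofR !ReIm;
  rewrite !(mul0r,mul1r,subr0,addr0,add0r).
Qed.

Lemma nbhs_cabsP (w : C) (A : set C) :
  nbhs w A <-> exists2 e : R, 0 < e & forall v, cabs (v - w) < e -> A v.
Proof.
split.
  case/nbhs_normP => e /= e0 eA; exists (re e).
    by move: e0; rewrite ltcE => /andP[].
  move=> v vw; apply: eA => /=.
  rewrite distrC normE; move: e0 vw; rewrite ltcE /re; case: e => a b /=.
  by move=> /andP[/eqP -> _] vw; rewrite ltcE /= eqxx.
case=> e e0 eA; apply/nbhs_normP; exists (ofR e) => /=.
  by rewrite ltcE /= eqxx.
by move=> v /=; rewrite distrC normE ltcE /= => /andP[_]; exact: eA.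
Qed.

Lemma continuous_cabsP (s : C -> C) (w : C) : {for w, continuous s} <->
  forall e : R, 0 < e -> exists2 d : R, 0 < d &
    forall v, cabs (v - w) < d -> cabs (s v - s w) < e.
Proof.
split=> [sc e e0|H A].
  have /(sc _)/nbhs_cabsP[d d0 dP] : nbhs (s w) [set u | cabs (u - s w) < e].
    by apply/nbhs_cabsP; exists e.
  by exists d.
case/nbhs_cabsP => e /H[d d0 dP] eA; apply/nbhs_cabsP; exists d => // v /dP.
exact: eA.
Qed.

Lemma continuous_cabs (w : C) : {for w, continuous cabs}.
Proof.
move=> A /nbhs_normP[e /= e0 eA]; apply/nbhs_cabsP; exists e => // v vw.
apply: eA => /=; rewrite (le_lt_trans _ vw)// ler_norml.
have := lerB_cabs w (v - w); have := lerB_cabs v (w - v); rewrite [cabs (w - v)]cabsB.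
rewrite (_ : w + (v - w) = v); last by ring.
rewrite (_ : v + (w - v) = w); last by ring.
by move=> *; apply/andP; split; lra.
Qed.

Lemma continuous_at_cst (c w : C) : {for w, continuous (fun=> c)}.
Proof. exact: cst_continuous. Qed.

Lemma continuous_at_id (w : C) : {for w, continuous (fun v => v)}.
Proof. by move=> A. Qed.

Lemma continuous_atD (s t : C -> C) w : {for w, continuous s} ->
  {for w, continuous t} -> {for w, continuous (fun v => s v + t v)}.
Proof. by move=> sc tc; exact: (cvgD sc tc). Qed.

Lemma continuous_atN (s : C -> C) w : {for w, continuous s} ->
  {for w, continuous (fun v => - s v)}.
Proof. by move=> sc; exact: (cvgN sc). Qed.

Lemma continuous_atM (s t : C -> C) w : {for w, continuous s} ->
  {for w, continuous t} -> {for w, continuous (fun v => s v * t v)}.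
Proof. by move=> sc tc; exact: (cvgM sc tc). Qed.

Lemma continuous_atV (s : C -> C) w : {for w, continuous s} -> s w != 0 ->
  {for w, continuous (fun v => (s v)^-1)}.
Proof. by move=> sc sw; exact: (cvgV sw sc). Qed.

(** Caratheodory's form of complex differentiability: with a slope function
    that is continuous at the point, the rules for products, quotients and
    compositions become algebra on slopes, and removing a zero of [g] amounts to
    passing from [g] to its slope. *)
Definition cderiv (g : C -> C) (w d : C) := exists s : C -> C,
  [/\ {for w, continuous s}, s w = d & forall v, g v = g w + s v * (v - w)].

Definition cdiff (g : C -> C) (w : C) := exists d, cderiv g w d.

Lemma continuous_near (T : topologicalType) (g h : C -> T) (w : C) :
  {for w, continuous g} -> (\forall v \near w, g v = h v) ->
  {for w, continuous h}.
Proof.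
move=> gc gh; have ghw : g w = h w by exact: nbhs_singleton gh.
move=> A; rewrite -ghw => /gc gA.
by apply: filterS2 gh gA => v /= ->.
Qed.

(** The slope can be redefined away from the point, so the global equation in
    [cderiv] costs nothing: differentiability stays a local notion. *)
Lemma cderiv_near g h w d : cderiv g w d ->
  (\forall v \near w, g v = h v) -> cderiv h w d.
Proof.
move=> [s [sc sw sg]] gh; have ghw : g w = h w by exact: nbhs_singleton gh.
exists (fun v => if v == w then d else (h v - h w) / (v - w)); split.
- apply: continuous_near sc _; near=> v; case: eqP => [->//|/eqP vw].
  rewrite -(near gh v)// -ghw sg addrC addKr mulfK// subr_eq0//.
- by rewrite eqxx.
- move=> v; case: eqP => [->|/eqP vw]; first by rewrite subrr mulr0 addr0.
  by rewrite divfK ?subr_eq0// addrC subrK.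
Unshelve. all: by end_near. Qed.

Lemma cdiff_near g h w : cdiff g w ->
  (\forall v \near w, g v = h v) -> cdiff h w.
Proof. by move=> [d gd] gh; exists d; exact: cderiv_near gh. Qed.

Lemma cderiv_continuous g w d : cderiv g w d -> {for w, continuous g}.
Proof.
move=> [s [sc sw sg]].
apply: (@continuous_near C (fun v => g w + s v * (v - w)) g w).
  apply: continuous_atD; first exact: continuous_at_cst.
  apply: (continuous_atM sc); apply: continuous_atD.
    exact: continuous_at_id.
  exact: continuous_at_cst.
by near=> v; rewrite -sg.
Unshelve. all: by end_near. Qed.

Lemma cdiff_continuous g w : cdiff g w -> {for w, continuous g}.
Proof. by move=> [d]; exact: cderiv_continuous. Qed.

Lemma cderiv_comp g h w d d' : cderiv g w d -> cderiv h (g w) d' ->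
  cderiv (h \o g) w (d' * d).
Proof.
move=> gd [s' [s'c s'w s'h]]; have gc := cderiv_continuous gd.
case: gd => s [sc sw sg]; exists (fun v => s' (g v) * s v); split.
- exact: (continuous_atM (continuous_comp gc s'c) sc).
- by rewrite sw s'w.
- by move=> v /=; rewrite s'h {2}(sg v); ring.
Qed.

Lemma cdiff_comp g h w : cdiff g w -> cdiff h (g w) -> cdiff (h \o g) w.
Proof. by move=> [d gd] [d' hd]; exists (d' * d); exact: cderiv_comp. Qed.

Lemma cderiv_id w : cderiv id w 1.
Proof.
exists (fun=> 1); split; [exact: continuous_at_cst|by []|].
by move=> v; rewrite mul1r addrC subrK.
Qed.

Lemma cdiff_id w : cdiff id w.
Proof. exists 1; exact: cderiv_id. Qed.

Lemma cdiff_cst c w : cdiff (fun=> c) w.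
Proof.
exists 0, (fun=> 0); split; [exact: continuous_at_cst|by []|].
by move=> v; rewrite mul0r addr0.
Qed.

Lemma cdiffD g h w : cdiff g w -> cdiff h w -> cdiff (fun v => g v + h v) w.
Proof.
move=> [_ [s [sc _ sg]]] [_ [t [tc _ th]]].
exists (s w + t w), (fun v => s v + t v); split; [exact: (continuous_atD sc tc)|by []|].
by move=> v; rewrite sg th; ring.
Qed.

Lemma cdiffM g h w : cdiff g w -> cdiff h w -> cdiff (fun v => g v * h v) w.
Proof.
move=> gd hd; have hc := cdiff_continuous hd.
move: gd hd => [_ [s [sc _ sg]]] [_ [t [tc _ th]]].
exists (s w * h w + g w * t w), (fun v => s v * h v + g w * t v).
split; [|by []|].
  apply: (continuous_atD (continuous_atM sc hc)).
  exact: (continuous_atM (@continuous_at_cst (g w) w) tc).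
by move=> v; rewrite (sg v) (th v); ring.
Qed.

Lemma cdiffN g w : cdiff g w -> cdiff (fun v => - g v) w.
Proof.
move=> gd; have -> : (fun v => - g v) = (fun v => (-1) * g v).
  by apply/funext => v; rewrite mulN1r.
by apply: cdiffM => //; exact: cdiff_cst.
Qed.

Lemma cdiffB g h w : cdiff g w -> cdiff h w -> cdiff (fun v => g v - h v) w.
Proof. by move=> gd hd; apply: cdiffD => //; exact: cdiffN. Qed.

Lemma cdiffX g w n : cdiff g w -> cdiff (fun v => g v ^+ n) w.
Proof.
move=> gd; elim: n => [|n IH]; first exact: cdiff_cst.
have -> : (fun v => g v ^+ n.+1) = (fun v => g v * g v ^+ n).
  by apply/funext => v; rewrite exprS.
exact: cdiffM.
Qed.

Lemma near_neq0 (g : C -> C) w : {for w, continuous g} -> g w != 0 ->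
  \forall v \near w, g v != 0.
Proof.
move=> /continuous_cabsP gc gw; have := gc (cabs (g w)); rewrite cabs_gt0.
move=> /(_ gw)[d d0 dP]; apply/nbhs_cabsP; exists d => // v /dP.
by apply: contraTN => /eqP ->; rewrite sub0r cabsN ltxx.
Qed.

Lemma cdiffV g w : cdiff g w -> g w != 0 -> cdiff (fun v => (g v)^-1) w.
Proof.
move=> gd gw; have gc := cdiff_continuous gd.
case: gd => _ [s [sc _ sg]].
have : cdiff (fun v => (g w)^-1 - s v * (g w * g v)^-1 * (v - w)) w.
  exists (- (s w * (g w * g w)^-1)), (fun v => - (s v * (g w * g v)^-1)).
  split; [|by []|by move=> v; rewrite subrr mulr0; ring].
  apply: continuous_atN; apply: (continuous_atM sc (continuous_atV _ _)).
    exact: (continuous_atM (@continuous_at_cst (g w) w) gc).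
  by rewrite mulf_neq0.
move=> /cdiff_near; apply; apply: filterS (near_neq0 gc gw) => v gv.
rewrite -[s v * _ * _]mulrAC [s v * _](_ : _ = g v - g w); last first.
  by rewrite (sg v); ring.
by field; rewrite gw gv.
Qed.

Lemma cdiff_div g h w : cdiff g w -> cdiff h w -> h w != 0 ->
  cdiff (fun v => g v / h v) w.
Proof. by move=> gd hd h0; apply: cdiffM => //; exact: cdiffV. Qed.

Lemma cderiv_unique g w d d' : cderiv g w d -> cderiv g w d' -> d = d'.
Proof.
move=> [s [/continuous_cabsP sc <- sg]] [t [/continuous_cabsP tc <- tg]].
apply/eqP; rewrite -subr_eq0 -cabs_eq0; apply: contraT => n0.
have e0 : 0 < cabs (s w - t w) / 2 by rewrite divr_gt0// lt0r n0 cabs_ge0.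
have [a a0 aP] := sc _ e0; have [b b0 bP] := tc _ e0.
pose m := Num.min a b / 2.
have m0 : 0 < m by rewrite divr_gt0// lt_min a0.
have mE : cabs (w + ofR m - w) = m.
  by rewrite addrC addKr cabs_ofR gtr0_norm.
have mab : m < a /\ m < b.
  have : Num.min a b <= a by rewrite ge_min lexx.
  have : Num.min a b <= b by rewrite ge_min lexx orbT.
  by move: m0; rewrite /m; split; lra.
have := aP (w + ofR m); have := bP (w + ofR m); rewrite mE.
move=> /(_ mab.2) B /(_ mab.1) A.
have E : s (w + ofR m) = t (w + ofR m).
  have := tg (w + ofR m); rewrite sg => /addrI /mulIf; apply.
  by rewrite -cabs_gt0 mE.
move: A B; rewrite E cabsB => A B.
have := ler_cabsD (s w - t (w + ofR m)) (t (w + ofR m) - t w).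
by rewrite addrA subrK; lra.
Qed.

Lemma is_derive_cderiv (g : C -> C) (w d : C) : is_derive w 1 g d -> cderiv g w d.
Proof.
move=> gd; have gD : derivable g w 1 by exact: ex_derive.
have : 'D_1 g w = d by exact: derive_val.
rewrite /derive => dE.
have /cvgrPdist_lt H : (fun h : C => h^-1 *: ((g \o shift w) (h *: 1) - g w)) @ 0^' --> d.
  by rewrite -dE; exact: gD.
exists (fun v => if v == w then d else (g v - g w) / (v - w)); split.
- apply/continuous_cabsP => e e0; rewrite eqxx.
  have := H (ofR e); rewrite ltcE /= eqxx /= => /(_ e0).
  rewrite /dnbhs /within /= => /nbhs_cabsP[b b0 bP]; exists b => // v vw.
  case: eqP => [_|/eqP vnw]; first by rewrite subrr cabs0.
  have := bP (v - w); rewrite subr0 subr_eq0 => /(_ vw vnw).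
  rewrite /= [(v - w) *: 1]mulr1 subrK normE ltcE /= => /andP[_].
  by rewrite -/(cabs _) cabsB mulrC.
- by rewrite eqxx.
- move=> v; case: eqP => [->|/eqP vw]; first by rewrite subrr mulr0 addr0.
  by rewrite divfK ?subr_eq0// addrC subrK.
Qed.

Lemma derivable_cdiff (g : C -> C) (w : C) : derivable g w 1 -> cdiff g w.
Proof. by move=> /derivableP /is_derive_cderiv gd; exists ('D_1 g w). Qed.

End Plane.

(** * Cauchy's theorem on squares *)

Section Goursat.
Variable R : realType.
Local Notation C := (cplx R).
Implicit Types (f g : C -> C) (a b v w z : C) (s d : R).

Lemma ofR_inv2 : ofR (2^-1 : R) = 2^-1.
Proof. by rewrite /ofR fmorphV rmorph_nat. Qed.

Lemma re_mid a b : re ((a + b) / 2) = (re a + re b) / 2.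
Proof. by rewrite -ofR_inv2 !ReIm mulr0 subr0. Qed.

Lemma im_mid a b : im ((a + b) / 2) = (im a + im b) / 2.
Proof. by rewrite -ofR_inv2 !ReIm mulr0 add0r. Qed.

(** The midpoint rule on [a, b] after [k] halvings; as [k] grows it plays the
    part of the mean value of [f] on the segment. *)
Fixpoint dyadic_mean f (k : nat) (a b : C) : C :=
  let m := (a + b) / 2 in
  if k is k'.+1 then (dyadic_mean f k' a m + dyadic_mean f k' m b) / 2
  else f m.

Definition mid_closed (P : set C) := forall x y, P x -> P y -> P ((x + y) / 2).

(** A mean of values lying in a convex set stays in it.  Half-planes and discs
    are the sets used below, and closure under midpoints is all that the dyadic
    construction can see of convexity. *)
Lemma dyadic_mean_in (P H : set C) f k a b : mid_closed P -> mid_closed H ->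
  (forall v, P v -> H (f v)) -> P a -> P b -> H (dyadic_mean f k a b).
Proof.
move=> Pm Hm PH; elim: k a b => [|k IH] a b Pa Pb /=; first exact/PH/Pm.
by apply: Hm; apply: IH => //; exact: Pm.
Qed.

Lemma dyadic_meanD f g k a b :
  dyadic_mean (fun v => f v + g v) k a b = dyadic_mean f k a b + dyadic_mean g k a b.
Proof. by elim: k a b => [//|k IH] a b /=; rewrite !IH; ring. Qed.

Lemma dyadic_meanZ c f k a b :
  dyadic_mean (fun v => c * f v) k a b = c * dyadic_mean f k a b.
Proof. by elim: k a b => [//|k IH] a b /=; rewrite !IH; ring. Qed.

Lemma dyadic_mean_affine (c d : C) k a b :
  dyadic_mean (fun v => c + d * v) k a b = c + d * ((a + b) / 2).
Proof. by elim: k a b => [//|k IH] a b /=; rewrite !IH; field. Qed.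

Definition edge f k a b := (b - a) * dyadic_mean f k a b.

Lemma edge_split f k a b m : m = (a + b) / 2 ->
  edge f k.+1 a b = edge f k a m + edge f k m b.
Proof. by move=> ->; rewrite /edge /=; field. Qed.

(** The contour sum of [f] around the square with lower left corner [z] and side
    [s], the upper and left sides being travelled backwards. *)
Definition boundary_sum f k z s :=
  edge f k z (z + ofR s) +
  edge f k (z + ofR s) (z + ofR s + iC R * ofR s) -
  edge f k (z + iC R * ofR s) (z + ofR s + iC R * ofR s) -
  edge f k z (z + iC R * ofR s).

(** The inner edges cancel exactly, because a subdivided side is the
    concatenation of the sides of the quarters. *)
Lemma boundary_sum_quarters f k z s : let h := s / 2 in
  boundary_sum f k.+1 z s = boundary_sum f k z h + boundary_sum f k (z + ofR h) h +
    boundary_sum f k (z + iC R * ofR h) h + boundary_sum f k (z + ofR h + iC R * ofR h) h.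
Proof.
move=> h; rewrite /boundary_sum.
have -> : ofR s = ofR h + ofR h by rewrite -ofRD /h; congr ofR; lra.
move: (ofR h) (iC R) => e i.
rewrite (@edge_split _ _ z (z + (e + e)) (z + e)); last by field.
rewrite (@edge_split _ _ (z + (e + e)) _ (z + e + e + i * e)); last by field.
rewrite (@edge_split _ _ (z + i * (e + e)) _ (z + e + i * e + i * e)); last by field.
rewrite (@edge_split _ _ z (z + i * (e + e)) (z + i * e)); last by field.
rewrite (_ : z + (e + e) = z + e + e); last by ring.
rewrite (_ : z + i * (e + e) = z + i * e + i * e); last by ring.
rewrite (_ : z + e + e + i * (e + e) = z + e + i * e + e + i * e); last by ring.
rewrite (_ : z + e + e + i * e = z + e + i * e + e); last by ring.
rewrite (_ : z + i * e + e = z + e + i * e); last by ring.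
move: (edge f k) => E.
ring.
Qed.

Lemma boundary_sumD f g k z s :
  boundary_sum (fun v => f v + g v) k z s = boundary_sum f k z s + boundary_sum g k z s.
Proof. by rewrite /boundary_sum /edge !dyadic_meanD; ring. Qed.

Lemma boundary_sumZ c f k z s :
  boundary_sum (fun v => c * f v) k z s = c * boundary_sum f k z s.
Proof. by rewrite /boundary_sum /edge !dyadic_meanZ; ring. Qed.

(** The midpoint rule is exact on affine functions, which have a primitive. *)
Lemma boundary_sum_affine (c d : C) k z s : boundary_sum (fun v => c + d * v) k z s = 0.
Proof. by rewrite /boundary_sum /edge !dyadic_mean_affine; field. Qed.

Definition square z s : set C := [set v |
  [/\ re z <= re v, re v <= re z + s, im z <= im v & im v <= im z + s]].

Definition square_boundary z s : set C := square z s `&` [set v |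
  [\/ re v = re z, re v = re z + s, im v = im z | im v = im z + s]].

Definition hside z s (y : R) : set C :=
  [set v | [/\ re z <= re v, re v <= re z + s & im v = y]].
Definition vside z s (x : R) : set C :=
  [set v | [/\ im z <= im v, im v <= im z + s & re v = x]].

Lemma hside_mid z s y : mid_closed (hside z s y).
Proof.
by move=> v w [v1 v2 v3] [w1 w2 w3]; split; rewrite ?re_mid ?im_mid; lra.
Qed.

Lemma vside_mid z s y : mid_closed (vside z s y).
Proof.
by move=> v w [v1 v2 v3] [w1 w2 w3]; split; rewrite ?re_mid ?im_mid; lra.
Qed.

Lemma hedge_in (H : set C) f k z a s y : 0 <= s -> re a = re z -> im a = y ->
  mid_closed H -> (forall v, hside z s y v -> H (f v)) ->
  exists2 e, H e & edge f k a (a + ofR s) = ofR s * e.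
Proof.
move=> s0 az ay Hm fH; exists (dyadic_mean f k a (a + ofR s)).
  apply: (dyadic_mean_in k (@hside_mid z s y) Hm fH);
    by split; rewrite ?ReIm; lra.
by rewrite /edge addrC addKr.
Qed.

Lemma vedge_in (H : set C) f k z a s y : 0 <= s -> im a = im z -> re a = y ->
  mid_closed H -> (forall v, vside z s y v -> H (f v)) ->
  exists2 e, H e & edge f k a (a + iC R * ofR s) = iC R * ofR s * e.
Proof.
move=> s0 az ay Hm fH; exists (dyadic_mean f k a (a + iC R * ofR s)).
  apply: (dyadic_mean_in k (@vside_mid z s y) Hm fH);
    by split; rewrite ?ReIm ?(mul0r, mulr0, mul1r, addr0, add0r, subr0); lra.
by rewrite /edge addrC addKr.
Qed.

(** Convex constraints on the values of [f] along each side give the same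
    constraints on one mean value per side; this serves both for upper bounds in
    modulus and for the positivity of the winding sum. *)
Lemma boundary_sum_in (H1 H2 H3 H4 : set C) f k z s : 0 <= s ->
  mid_closed H1 -> mid_closed H2 -> mid_closed H3 -> mid_closed H4 ->
  (forall v, hside z s (im z) v -> H1 (f v)) ->
  (forall v, vside z s (re z + s) v -> H2 (f v)) ->
  (forall v, hside z s (im z + s) v -> H3 (f v)) ->
  (forall v, vside z s (re z) v -> H4 (f v)) ->
  exists e1 e2 e3 e4, [/\ H1 e1, H2 e2, H3 e3, H4 e4 &
    boundary_sum f k z s = ofR s * (e1 - e3 + iC R * (e2 - e4))].
Proof.
move=> s0 m1 m2 m3 m4 f1 f2 f3 f4.
have [e1 He1 E1] := hedge_in k s0 erefl erefl m1 f1.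
have [||e2 He2 E2] := @vedge_in _ _ k _ (z + ofR s) _ _ s0 _ _ m2 f2.
- by rewrite !ReIm addr0.
- by rewrite !ReIm.
have [||e3 He3 E3] := @hedge_in _ _ k _ (z + iC R * ofR s) _ _ s0 _ _ m3 f3.
- by rewrite !ReIm !(mul0r, mulr0, mul1r, addr0, add0r, subr0).
- by rewrite !ReIm !(mul0r, mulr0, mul1r, addr0, add0r, subr0).
have [e4 He4 E4] := vedge_in k s0 erefl erefl m4 f4.
exists e1, e2, e3, e4; split=> //.
rewrite /boundary_sum E1 E2 E4.
rewrite (_ : z + ofR s + iC R * ofR s = z + iC R * ofR s + ofR s); last by ring.
by rewrite E3; ring.
Qed.

Lemma square_boundary_sides z s v : 0 <= s ->
  [\/ hside z s (im z) v, vside z s (re z + s) v,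
      hside z s (im z + s) v | vside z s (re z) v] -> square_boundary z s v.
Proof.
move=> s0 []; move=> [v1 v2 v3]; split; try (by split; lra).
- by constructor 3.
- by constructor 2.
- by constructor 4.
- by constructor 1.
Qed.

Lemma mid_closed_cabs M : mid_closed [set v | cabs v <= M].
Proof.
move=> x y /= xM yM; rewrite -ofR_inv2 cabsM cabs_ofR gtr0_norm ?invr_gt0//.
by rewrite ler_pdivrMr// (le_trans (ler_cabsD _ _))//; lra.
Qed.

Lemma boundary_sum_le f k z s M : 0 <= s ->
  (forall v, square_boundary z s v -> cabs (f v) <= M) ->
  cabs (boundary_sum f k z s) <= 4 * s * M.
Proof.
move=> s0 fM; have m := @mid_closed_cabs M.
have [] := @boundary_sum_in _ _ _ _ f k z s s0 m m m m.
- by move=> v H; apply/fM/square_boundary_sides => //; constructor 1.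
- by move=> v H; apply/fM/square_boundary_sides => //; constructor 2.
- by move=> v H; apply/fM/square_boundary_sides => //; constructor 3.
- by move=> v H; apply/fM/square_boundary_sides => //; constructor 4.
move=> e1 [e2 [e3 [e4 [/= h1 h2 h3 h4 ->]]]].
rewrite cabsM cabs_ofR ger0_norm// [4 * s]mulrC -mulrA ler_wpM2l//.
rewrite (le_trans (ler_cabsD _ _))// cabsM cabs_iC mul1r.
by have := ler_cabsB e1 e3; have := ler_cabsB e2 e4; lra.
Qed.

Lemma nested_intervals (a b : nat -> R) :
  (forall j, a j <= a j.+1) -> (forall j, b j.+1 <= b j) ->
  (forall j, a j <= b j) -> exists x, forall j, a j <= x <= b j.
Proof.
move=> aS bS ab.
have am : {homo a : m n / (m <= n)%N >-> m <= n}.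
  by apply: homo_leq => // x y z; exact: le_trans.
have bm : {homo b : m n / (m <= n)%N >-> n <= m}.
  by apply: homo_leq => // x y z xy yz; exact: le_trans yz xy.
have ub j : ubound (range a) (b j).
  move=> _ [i _ <-]; rewrite (le_trans (am i (maxn i j) _)) ?leq_maxl//.
  by rewrite (le_trans (ab _))// bm// leq_maxr.
exists (sup (range a)) => j; apply/andP; split.
  by apply: ub_le_sup; [exists (b 0%N)|exists j].
by apply: ge_sup => //; exists (a 0%N), 0%N.
Qed.

Lemma halving_small s d : 0 < d -> exists j : nat, s / 2 ^+ j < d.
Proof.
move=> d0; have [n nP] : exists n : nat, s / d < n%:R.
  exists (Num.bound `|s / d|).
  exact: le_lt_trans (ler_norm _) (archi_boundP (normr_ge0 _)).
exists n; rewrite ltr_pdivrMr ?exprn_gt0// mulrC -ltr_pdivrMr//.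
by rewrite (lt_trans nP)// -natrX ltr_nat ltn_expl.
Qed.

(** Near a point of differentiability [f] is affine up to an error that is small
    compared with the size of the square, and the affine part contributes
    nothing. *)
Lemma boundary_sum_small_scale f w (e : R) : cdiff f w -> 0 < e ->
  exists2 d, 0 < d & forall k z s, 0 <= s -> 2 * s < d -> square z s w ->
    cabs (boundary_sum f k z s) <= e * s ^+ 2.
Proof.
move=> [_ [t [/continuous_cabsP tc _ ft]]] e0.
have [d d0 dP] := tc (e / 8) (divr_gt0 e0 (ltr0Sn R 7)).
exists d => // k z s s0 sd [w1 w2 w3 w4].
have -> : boundary_sum f k z s = boundary_sum (fun v => (t v - t w) * (v - w)) k z s.
  have -> : f = fun v => (f w - t w * w + t w * v) + (t v - t w) * (v - w).
    by apply/funext => v; rewrite ft; ring.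
  by rewrite boundary_sumD boundary_sum_affine add0r.
have -> : e * s ^+ 2 = 4 * s * ((e / 8) * (2 * s)) by field.
apply: boundary_sum_le => // v [[v1 v2 v3 v4] _]; rewrite cabsM.
have vw : cabs (v - w) <= 2 * s.
  rewrite (le_trans (ler_reim _))// !ReIm.
  have : `|re v - re w| <= s by rewrite ler_norml; apply/andP; split; lra.
  have : `|im v - im w| <= s by rewrite ler_norml; apply/andP; split; lra.
  by lra.
by apply: ler_pM => //; rewrite ?cabs_ge0// ltW// dP//; exact: le_lt_trans sd.
Qed.

(** Cauchy's theorem.  If the estimate failed for infinitely many [k], it would
    fail in the same way for one of the four quarters, relative to its area;
    iterating, the squares would shrink to a point where [f] is differentiable,
    against [boundary_sum_small_scale]. *)
Lemma goursat f z s (e : R) : 0 < s -> 0 < e ->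
  (forall v, square z s v -> cdiff f v) ->
  \forall k \near \oo, cabs (boundary_sum f k z s) <= e * s ^+ 2.
Proof.
move=> s0 e0 fd.
pose good (p : C * R) := \forall k \near \oo,
  cabs (boundary_sum f k p.1 p.2) <= e * p.2 ^+ 2.
pose quarter (p q : C * R) := [/\ q.2 = p.2 / 2,
  re p.1 <= re q.1 <= re p.1 + p.2 / 2 & im p.1 <= im q.1 <= im p.1 + p.2 / 2].
have step p : 0 <= p.2 -> ~ good p -> exists q, quarter p q /\ ~ good q.
  move=> p0 pbad; apply: contrapT => noq; apply: pbad.
  have Q q : quarter p q -> good q.
    by move=> pq; apply: contrapT => qbad; apply: noq; exists q.
  pose h := p.2 / 2.
  have h0 : 0 <= h by rewrite divr_ge0.
  have G1 : good (p.1, h) by apply: Q; split => //=; rewrite lexx -/h; lra.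
  have G2 : good (p.1 + ofR h, h).
    by apply: Q; split => //=; rewrite !ReIm -/h; lra.
  have G3 : good (p.1 + iC R * ofR h, h).
    apply: Q; split => //=; rewrite !ReIm -/h;
     by rewrite ?(mul0r, mulr0, mul1r, addr0, add0r, subr0); lra.
  have G4 : good (p.1 + ofR h + iC R * ofR h, h).
    apply: Q; split => //=; rewrite !ReIm -/h;
     by rewrite ?(mul0r, mulr0, mul1r, addr0, add0r, subr0); lra.
  have [N _ NP] : \forall k \near \oo, cabs (boundary_sum f k.+1 p.1 p.2) <= e * p.2 ^+ 2.
    near=> k; rewrite boundary_sum_quarters -/h.
    have := near G1 k; have := near G2 k; have := near G3 k; have := near G4 k.
    rewrite /= => A4 A3 A2 A1.
    rewrite (le_trans (ler_cabsD _ _))// (le_trans (lerD (ler_cabsD _ _) (A4 _)))//.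
    rewrite (le_trans (lerD (lerD (ler_cabsD _ _) (A3 _)) (lexx _)))//.
    rewrite (le_trans (lerD (lerD (lerD (A1 _) (A2 _)) (lexx _)) (lexx _)))//.
    by rewrite /h; nra.
  exists N.+1 => // -[//|k] /= kN; exact: NP.
have [nx nxP] : exists nx : C * R -> C * R, forall p, 0 <= p.2 -> ~ good p ->
    quarter p (nx p) /\ ~ good (nx p).
  have : forall p, exists q, 0 <= p.2 -> ~ good p -> quarter p q /\ ~ good q.
    move=> p; have [[p0 pb]|npb] := pselect (0 <= p.2 /\ ~ good p).
      by have [q] := step p p0 pb; exists q.
    by exists p => p0 pb; case: npb.
  by move=> /choice[nx nxP]; exists nx.
apply: contrapT => bad.
pose p j := iter j nx (z, s).
have pP j : (p j).2 = s / 2 ^+ j /\ ~ good (p j).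
  elim: j => [|j [jE jb]]; first by rewrite /= expr0 divr1.
  have j0 : 0 <= (p j).2 by rewrite jE divr_ge0 ?exprn_ge0// ltW.
  have [[q1 _ _] q2] := nxP _ j0 jb; split=> //=.
  by rewrite q1 jE exprS invfM [2^-1 * _]mulrC mulrA.
have pq j : quarter (p j) (p j.+1).
  have [jE jb] := pP j.
  by apply: (nxP _ _ jb).1; rewrite jE divr_ge0 ?exprn_ge0// ltW.
have p0 j : 0 < (p j).2 by rewrite (pP j).1 divr_gt0// exprn_gt0.
have [x xP] : exists x, forall j, re (p j).1 <= x <= re (p j).1 + (p j).2.
  by apply: nested_intervals => j; have [qE /andP[? ?] _] := pq j; have := p0 j; lra.
have [y yP] : exists y, forall j, im (p j).1 <= y <= im (p j).1 + (p j).2.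
  by apply: nested_intervals => j; have [qE _ /andP[? ?]] := pq j; have := p0 j; lra.
pose w : C := ofR x + iC R * ofR y.
have [rw iw] : re w = x /\ im w = y.
  by rewrite /w !ReIm !(mul0r, mulr0, mul1r, addr0, add0r, subr0).
have wP j : square (p j).1 (p j).2 w.
  by have /andP[? ?] := xP j; have /andP[? ?] := yP j; split; rewrite ?rw ?iw.
have [d d0 dP] := boundary_sum_small_scale (fd w (wP 0%N)) e0.
have [j jd] := halving_small s (divr_gt0 d0 (ltr0Sn R 1)).
apply: (pP j).2; exists 0%N => // k _ /=; apply: dP => //; first exact: ltW.
by rewrite (pP j).1; lra.
Unshelve. all: by end_near. Qed.

End Goursat.

(** * The maximum principle *)

Section MaxPrinciple.
Variable R : realType.
Local Notation C := (cplx R).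
Implicit Types (f g : C -> C) (u v w z : C) (s rho M : R).

Lemma re_inv u : re u^-1 = re u / cabs u ^+ 2.
Proof. by rewrite cabs_sqr; case: u => a b. Qed.

Lemma im_inv u : im u^-1 = - im u / cabs u ^+ 2.
Proof. by rewrite cabs_sqr; case: u => a b; rewrite mulNr. Qed.

Definition square_core z s rho w := [/\ re z + rho <= re w, re w <= re z + s - rho,
  im z + rho <= im w & im w <= im z + s - rho].

Lemma square_dist z s v w : square z s v -> square z s w -> cabs (v - w) <= 2 * s.
Proof.
move=> [v1 v2 v3 v4] [w1 w2 w3 w4].
rewrite (le_trans (ler_reim _))// !ReIm.
have : `|re v - re w| <= s by rewrite ler_norml; apply/andP; split; lra.
have : `|im v - im w| <= s by rewrite ler_norml; apply/andP; split; lra.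
by lra.
Qed.

Lemma square_core_square z s rho w : 0 <= rho -> square_core z s rho w -> square z s w.
Proof. by move=> r0 [w1 w2 w3 w4]; split; lra. Qed.

Lemma square_core_dist z s rho v w : 0 <= rho ->
  square_core z s rho w -> square_boundary z s v -> rho <= cabs (v - w).
Proof.
move=> r0 [w1 w2 w3 w4] [_ vb].
have [H|H] : rho <= `|re (v - w)| \/ rho <= `|im (v - w)|.
  rewrite !ReIm !ler_normr /= in vb *; case: vb => vE; rewrite vE;
    [left|left|right|right]; apply/orP; [right|left|right|left]; lra.
- exact: le_trans H (ler_re _).
- exact: le_trans H (ler_im _).
Qed.

(** The sum of [1 / (v - w)] turns around [w]: on each of the four sides the
    contribution to its imaginary part is positive, so it stays away from 0. *)
Lemma winding_ge k z s rho w : 0 < rho -> square_core z s rho w ->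
  rho / s <= cabs (boundary_sum (fun v => (v - w)^-1) k z s).
Proof.
move=> r0 wd; have wi := square_core_square (ltW r0) wd; move: (wd) => [w1 w2 w3 w4].
have s0 : 0 < s by lra.
pose kap := rho / (4 * s ^+ 2).
have kapP (x : R) v : square_boundary z s v -> rho <= x -> kap <= x / cabs (v - w) ^+ 2.
  move=> vb rx; have vd := square_core_dist (ltW r0) wd vb.
  have vp : 0 < cabs (v - w) := lt_le_trans r0 vd.
  have s4 : 0 < 4 * s ^+ 2 by rewrite mulr_gt0// exprn_gt0.
  apply: ler_pM; [exact: ltW|by rewrite invr_ge0 ltW|by []|].
  rewrite lef_pV2 ?posrE//; last exact: exprn_gt0.
  rewrite (_ : 4 * s ^+ 2 = (2 * s) ^+ 2); last by ring.
  by rewrite lerXn2r ?nnegrE ?cabs_ge0 ?mulr_ge0 ?(ltW s0)//; apply: square_dist vb.1 _.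
have midre (c : R) : mid_closed [set u : C | c <= re u].
  by move=> x y /= xc yc; rewrite re_mid; lra.
have midre' (c : R) : mid_closed [set u : C | re u <= - c].
  by move=> x y /= xc yc; rewrite re_mid; lra.
have midim (c : R) : mid_closed [set u : C | c <= im u].
  by move=> x y /= xc yc; rewrite im_mid; lra.
have midim' (c : R) : mid_closed [set u : C | im u <= - c].
  by move=> x y /= xc yc; rewrite im_mid; lra.
have [] := @boundary_sum_in _ _ _ _ _ (fun v => (v - w)^-1) k z s (ltW s0)
  (midim kap) (midre kap) (midim' kap) (midre' kap).
- move=> v vs; have vb : square_boundary z s v.
    by apply: (square_boundary_sides (ltW s0)); constructor 1.
  rewrite /= im_inv; apply: kapP => //; rewrite !ReIm; case: vs; lra.
- move=> v vs; have vb : square_boundary z s v.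
    by apply: (square_boundary_sides (ltW s0)); constructor 2.
  rewrite /= re_inv; apply: kapP => //; rewrite !ReIm; case: vs; lra.
- move=> v vs; have vb : square_boundary z s v.
    by apply: (square_boundary_sides (ltW s0)); constructor 3.
  rewrite /= im_inv mulNr lerN2; apply: kapP => //; rewrite !ReIm; case: vs; lra.
- move=> v vs; have vb : square_boundary z s v.
    by apply: (square_boundary_sides (ltW s0)); constructor 4.
  rewrite /= re_inv lerNr -mulNr; apply: kapP => //; rewrite !ReIm; case: vs; lra.
move=> e1 [e2 [e3 [e4 [/= h1 h2 h3 h4 ->]]]].
rewrite cabsM cabs_ofR gtr0_norm// (_ : rho / s = s * (4 * kap)); last first.
  by rewrite /kap; field; lra.
rewrite ler_pM2l//; apply: le_trans (ler_im _); rewrite !ReIm ler_normr.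
by apply/orP; left; rewrite !(mul0r, mul1r, add0r); lra.
Qed.

(** Squaring the numerator makes the quotient differentiable at [w] as well, so
    that Cauchy's theorem applies to it on a square containing [w]. *)
Lemma cdiff_sqr_quot f w : cdiff f w ->
  cdiff (fun v => (f v - f w) ^+ 2 / (v - w)) w.
Proof.
move=> [_ [t [tc _ ft]]].
exists (t w * t w), (fun v => t v * t v); split; [exact: continuous_atM|by []|].
move=> v; rewrite [w - w]subrr invr0 mulr0 add0r ft.
have [->|vw] := eqVneq v w; first by rewrite [w - w]subrr invr0 !mulr0.
by field; rewrite subr_eq0.
Qed.

(** Cauchy's theorem for [(f v - f w) ^+ 2 / (v - w)] expresses the square of
    [f w] times the winding sum through sums of [f ^+ 2 / (v - w)] and
    [f / (v - w)], which only see the boundary; solving the resulting quadratic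
    inequality bounds [f w]. *)
Lemma mean_value_bound f z s rho w M : 0 < rho -> 0 <= M -> square_core z s rho w ->
  (forall v, square z s v -> cdiff f v) ->
  (forall v, square_boundary z s v -> cabs (f v) <= M) ->
  cabs (f w) <= (1 + 12 * s ^+ 2 / rho ^+ 2) * M.
Proof.
move=> r0 M0 wd fd fM; have wi := square_core_square (ltW r0) wd.
have s0 : 0 < s by case: wd; lra.
pose x := cabs (f w); have x0 : 0 <= x := cabs_ge0 _.
have key : x ^+ 2 * (rho / s) <= 4 * s * (M ^+ 2 / rho) + 2 * x * (4 * s * (M / rho)).
  apply/ler_addgt0Pr => e e0.
  have es : 0 < e / s ^+ 2 by rewrite divr_gt0// exprn_gt0.
  have Fd v : square z s v -> cdiff (fun v => (f v - f w) ^+ 2 / (v - w)) v.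
    move=> vi; have [->|vw] := eqVneq v w; first exact/cdiff_sqr_quot/fd.
    apply: cdiff_div; last by rewrite subr_eq0.
      by apply: cdiffX; apply: cdiffB; [exact: fd|exact: cdiff_cst].
    by apply: cdiffB; [exact: cdiff_id|exact: cdiff_cst].
  have [k _ kP] := goursat s0 es Fd.
  have {kP} := kP k (leqnn k); rewrite divfK ?expf_neq0 ?gt_eqF//.
  have -> : (fun v => (f v - f w) ^+ 2 / (v - w)) =
    fun v => f v ^+ 2 / (v - w) + ((- 2 * f w) * (f v / (v - w)) +
      f w ^+ 2 * (v - w)^-1) by apply/funext => v; ring.
  rewrite !boundary_sumD !boundary_sumZ.
  have inv v : square_boundary z s v -> cabs (v - w)^-1 <= rho^-1.
    move=> vb; have vd := square_core_dist (ltW r0) wd vb.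
    by rewrite cabsV lef_pV2 ?posrE//; exact: lt_le_trans vd.
  have B1 : cabs (boundary_sum (fun v => f v ^+ 2 / (v - w)) k z s) <=
      4 * s * (M ^+ 2 / rho).
    apply: boundary_sum_le (ltW s0) _ => v vb; rewrite cabsM cabsX.
    apply: ler_pM; rewrite ?cabs_ge0 ?exprn_ge0 ?cabs_ge0//; last exact: inv.
    by rewrite lerXn2r ?nnegrE ?cabs_ge0 ?fM.
  have B2 : cabs (boundary_sum (fun v => f v / (v - w)) k z s) <= 4 * s * (M / rho).
    apply: boundary_sum_le (ltW s0) _ => v vb; rewrite cabsM.
    by apply: ler_pM; rewrite ?cabs_ge0 ?fM ?inv.
  have W := winding_ge k r0 wd.
  move: B1 B2 W; move: (boundary_sum _ k z s) => b1; move: (boundary_sum _ k z s) => b2.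
  move: (boundary_sum _ k z s) => W B1 B2 Wr H.
  have E : f w ^+ 2 * W = (b1 + (-2 * f w * b2 + f w ^+ 2 * W))
     - b1 + (ofR 2 * f w * b2) by rewrite /ofR rmorph_nat; ring.
  have H1 : x ^+ 2 * (rho / s) <= cabs (f w ^+ 2 * W).
    by rewrite cabsM cabsX ler_wpM2l ?exprn_ge0.
  rewrite (le_trans H1)// E (le_trans (ler_cabsD _ _))//.
  have H2 : cabs (ofR 2 * f w * b2) <= 2 * x * (4 * s * (M / rho)).
    by rewrite !cabsM cabs_ofR ger0_norm// ler_wpM2l// mulr_ge0.
  have := ler_cabsB (b1 + (-2 * f w * b2 + f w ^+ 2 * W)) b1; lra.
have [xM|Mx] := leP x M.
  rewrite (le_trans xM)// ler_peMl// lerDl divr_ge0 ?sqr_ge0//.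
  by rewrite mulr_ge0 ?sqr_ge0.
have xp : 0 < x by exact: le_lt_trans Mx.
have : x ^+ 2 * (rho / s) <= x * (M * (12 * (s / rho))).
  apply: le_trans key _.
  rewrite (_ : _ + _ = (M ^+ 2 + 2 * x * M) * (4 * (s / rho))); last first.
    by field; lra.
  rewrite (_ : x * _ = (3 * (x * M)) * (4 * (s / rho))); last by ring.
  apply: ler_wpM2r; first by rewrite mulr_ge0// divr_ge0// ltW.
  have : 0 <= (x - M) * M by rewrite mulr_ge0// subr_ge0 ltW.
  by rewrite mulrBl -expr2; lra.
rewrite expr2 -mulrA ler_pM2l// => H.
have : x <= 12 * s ^+ 2 / rho ^+ 2 * M.
  rewrite -(@ler_pM2r _ (rho / s)) ?divr_gt0// (le_trans H)//.
  by rewrite le_eqVlt; apply/orP; left; apply/eqP; field; lra.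
by rewrite mulrDl mul1r -/x; lra.
Qed.

Lemma bernoulli_inequality (y : R) (n : nat) : 1 <= y -> 1 + n%:R * (y - 1) <= y ^+ n.
Proof.
move=> y1; elim: n => [|n IH]; first by rewrite mul0r addr0 expr0.
rewrite exprS -natr1; have n0 : 0 <= n%:R :> R := ler0n _ _.
have : y * (1 + n%:R * (y - 1)) <= y * y ^+ n by rewrite ler_wpM2l//; lra.
apply: le_trans.
by have := mulr_ge0 n0 (sqr_ge0 (y - 1)); nra.
Qed.

(** Powers absorb any multiplicative constant, by Bernoulli's inequality. *)
Lemma power_trick (x M e c : R) : 0 <= M -> 0 < e ->
  (forall n : nat, x ^+ n * e <= M ^+ n * c) -> x <= M.
Proof.
move=> M0 e0 H; rewrite leNgt; apply/negP => Mx.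
have [Mz|Mn] := eqVneq M 0.
  by have := H 1%N; rewrite !expr1 Mz mul0r pmulr_lle0// leNgt -Mz Mx.
have Mp : 0 < M by rewrite lt0r Mn.
have y1 : 1 < x / M by rewrite ltr_pdivlMr// mul1r.
have [n nP] : exists n : nat, `|c / e / (x / M - 1)| < n%:R.
  by exists (Num.bound `|c / e / (x / M - 1)|); exact: archi_boundP.
have := H n; rewrite -ler_pdivlMr//; rewrite -mulrA mulrC -ler_pdivrMr ?exprn_gt0//.
rewrite -expr_div_n => /(le_trans (bernoulli_inequality n (ltW y1))) B.
have := le_lt_trans (ler_norm _) nP; rewrite ltr_pdivrMr ?subr_gt0//; lra.
Qed.

Lemma cdiff_mul_sub f v : {for v, continuous f} ->
  cdiff (fun w => f w * (w - v)) v.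
Proof.
move=> fc; exists (f v), f; split=> // w.
by rewrite [v - v]subrr mulr0 add0r.
Qed.

Lemma square_cases z s w : square z s w -> square_boundary z s w \/
  exists2 rho, 0 < rho & square_core z s rho w.
Proof.
move=> [w1 w2 w3 w4].
have [E|n1] := eqVneq (re w) (re z); first by left; split=> //; constructor 1.
have [E|n2] := eqVneq (re w) (re z + s).
  by left; split=> //; constructor 2.
have [E|n3] := eqVneq (im w) (im z); first by left; split=> //; constructor 3.
have [E|n4] := eqVneq (im w) (im z + s).
  by left; split=> //; constructor 4.
right; pose a := Num.min (re w - re z) (re z + s - re w).
pose b := Num.min (im w - im z) (im z + s - im w).
exists (Num.min a b).
  rewrite !lt_min !subr_gt0 !lt_neqAle w1 w2 w3 w4 n2 n4.
  by rewrite eq_sym n1 eq_sym n3.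
have H1 : Num.min a b <= a by rewrite ge_min lexx.
have H2 : Num.min a b <= b by rewrite ge_min lexx orbT.
have H3 : a <= re w - re z by rewrite ge_min lexx.
have H4 : a <= re z + s - re w by rewrite ge_min lexx orbT.
have H5 : b <= im w - im z by rewrite ge_min lexx.
have H6 : b <= im z + s - im w by rewrite ge_min lexx orbT.
split; lra.
Qed.

(** [mean_value_bound] for [f ^+ n] times [(v - p) * (v - q)]: the extra factor
    makes the product differentiable at the points [p] and [q] where [f] is only
    continuous, and it is absorbed with the constant as [n] grows. *)
Lemma max_principle f p q z s M :
  (forall v, square z s v -> v != p -> v != q -> cdiff f v) ->
  (forall v, square z s v -> {for v, continuous f}) ->
  (forall v, square_boundary z s v -> cabs (f v) <= M) ->
  forall w, square z s w -> w != p -> w != q -> cabs (f w) <= M.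
Proof.
move=> fd fc fM w wi wp wq.
have [wb|[rho r0 wd]] := square_cases wi; first exact: fM.
have s0 : 0 < s by case: wd; lra.
have M0 : 0 <= M.
  apply: le_trans (fM z _); first exact: cabs_ge0.
  by split; [split; lra|constructor 1].
pose D := (2 * s + cabs (z - p)) * (2 * s + cabs (z - q)).
apply: (@power_trick _ _ (cabs ((w - p) * (w - q)))
  ((1 + 12 * s ^+ 2 / rho ^+ 2) * D)) => // [|n].
  by rewrite cabs_gt0 mulf_neq0 ?subr_eq0.
have zi : square z s z by split; lra.
have dist v a : square z s v -> cabs (v - a) <= 2 * s + cabs (z - a).
  move=> vi; rewrite (_ : v - a = (v - z) + (z - a)); last by ring.
  by rewrite (le_trans (ler_cabsD _ _))// lerD2r; exact: square_dist vi zi.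
have D0 : 0 <= D.
  by rewrite mulr_ge0// addr_ge0 ?cabs_ge0// mulr_ge0 ?(ltW s0).
rewrite [_ * D]mulrC mulrA mulrC -cabsX -cabsM mulrC.
rewrite (_ : M ^+ n * D * _ = (1 + 12 * s ^+ 2 / rho ^+ 2) * (M ^+ n * D));
  last by rewrite mulrC.
apply: (@mean_value_bound (fun v => f v ^+ n * ((v - p) * (v - q)))
  z s rho w _ r0 _ wd).
- by rewrite mulr_ge0 ?exprn_ge0.
- move=> v vi.
  have d1 : cdiff (fun v => v - p) v.
    by apply: cdiffB; [exact: cdiff_id|exact: cdiff_cst].
  have d2 : cdiff (fun v => v - q) v.
    by apply: cdiffB; [exact: cdiff_id|exact: cdiff_cst].
  have fnc : {for v, continuous (fun v => f v ^+ n)}.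
    elim: n => [|n IH]; first exact: continuous_at_cst.
    have -> : (fun v => f v ^+ n.+1) = (fun v => f v * f v ^+ n).
      by apply/funext => u; rewrite exprS.
    exact: (continuous_atM (fc v vi) IH).
  have [vp|vp] := eqVneq v p.
    have -> : (fun v => f v ^+ n * ((v - p) * (v - q))) =
      (fun u => (f u ^+ n * (u - q)) * (u - v)).
      by apply/funext => u; rewrite vp; ring.
    apply: cdiff_mul_sub; exact: (continuous_atM fnc (cdiff_continuous d2)).
  have [vq|vq] := eqVneq v q.
    have -> : (fun v => f v ^+ n * ((v - p) * (v - q))) =
      (fun u => (f u ^+ n * (u - p)) * (u - v)).
      by apply/funext => u; rewrite vq; ring.
    apply: cdiff_mul_sub; exact: (continuous_atM fnc (cdiff_continuous d1)).
  by apply: cdiffM; [exact/cdiffX/fd|exact: cdiffM].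
- move=> v vb; rewrite cabsM cabsX cabsM.
  apply: ler_pM; rewrite ?exprn_ge0 ?mulr_ge0 ?cabs_ge0//.
    by rewrite lerXn2r ?nnegrE ?cabs_ge0 ?fM.
  by apply: ler_pM; rewrite ?cabs_ge0// dist//; case: vb.
Qed.

End MaxPrinciple.

(** * Squares around the origin and holomorphic square roots *)

Section Sqrt.
Variable R : realType.
Local Notation C := (cplx R).
Implicit Types (f g : C -> C) (u v w z : C) (r M : R).

(** The sup norm, whose balls are the squares centred at the origin. *)
Definition supn v : R := Num.max `|re v| `|im v|.

Lemma supn_le v r : (supn v <= r) = (`|re v| <= r) && (`|im v| <= r).
Proof. by rewrite ge_max. Qed.

Lemma supn_cabs v : supn v <= cabs v.
Proof. by rewrite supn_le ler_re ler_im. Qed.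

Lemma cabs_supn v : cabs v <= 2 * supn v.
Proof.
apply: le_trans (ler_reim v) _.
have := lexx (supn v); rewrite {1}supn_le => /andP[? ?]; lra.
Qed.

Lemma supnD v w : supn (v + w) <= supn v + supn w.
Proof.
have := lexx (supn v); rewrite {1}supn_le => /andP[? ?].
have := lexx (supn w); rewrite {1}supn_le => /andP[? ?].
rewrite supn_le !ReIm; apply/andP; split;
  rewrite (le_trans (ler_normD _ _))//; lra.
Qed.

Lemma supn_ofR r : supn (ofR r) = `|r|.
Proof. by rewrite /supn !ReIm normr0; apply/max_idPl. Qed.

Lemma supn0 : supn 0 = 0.
Proof. by rewrite /supn !ReIm normr0 maxxx. Qed.

Lemma supn1 : supn 1 = 1.
Proof. by rewrite /supn !ReIm normr0 normr1; apply/max_idPl. Qed.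

Lemma supn_ofRM (t : R) v : 0 <= t <= 1 -> supn (ofR t * v) <= supn v.
Proof.
move=> /andP[t0 t1]; have := lexx (supn v); rewrite {1}supn_le => /andP[? ?].
rewrite supn_le !ReIm !(mul0r, addr0, subr0) !normrM (ger0_norm t0).
by apply/andP; split; rewrite (le_trans _ (_ : 1 * supn v <= _)) ?mul1r//;
  rewrite -[X in _ <= X]mul1r; apply: ler_pM.
Qed.

Lemma continuous_supn v : {for v, continuous supn}.
Proof.
move=> A /nbhs_normP[e /= e0 eA]; apply/nbhs_cabsP; exists e => // w vw.
apply: eA => /=; rewrite (le_lt_trans _ vw)//.
have := supnD v (w - v); have := supnD w (v - w).
rewrite (_ : w + (v - w) = v); last by ring.
rewrite (_ : v + (w - v) = w); last by ring.
have := supn_cabs (w - v); have := supn_cabs (v - w); rewrite [cabs (v - w)]cabsB.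
by move=> *; rewrite ler_norml; apply/andP; split; lra.
Qed.

Lemma box_compact r : compact [set v | supn v <= r].
Proof.
pose m (p : R * R) : C := ofR p.1 + iC R * ofR p.2.
have mE : [set v | supn v <= r] = m @` (`[- r, r] `*` `[- r, r]).
  apply/seteqP; split=> [v /=|_ [[x y] [/= xr yr] <-]] /=.
    rewrite supn_le !ler_norml => /andP[? ?]; exists (re v, im v).
      by rewrite /= !in_itv.
    by apply: cplx_eq; rewrite !ReIm/= ; ring.
  move: xr yr; rewrite !in_itv /= -!ler_norml => xr yr.
  by rewrite supn_le /m !ReIm !(mul0r, mul1r, addr0, add0r, subr0) xr.
rewrite mE; apply: continuous_compact; last first.
  by apply: compact_setX; exact: segment_compact.
apply: continuous_subspaceT => -[x y] A /nbhs_cabsP[e e0 eA].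
have e2 : 0 < e / 2 by rewrite divr_gt0.
exists (ball x (e / 2), ball y (e / 2)) => /=.
  by split; exact: nbhsx_ballx.
move=> [x' y'] [/= xx yy]; apply: eA.
apply: le_lt_trans (ler_reim _) _.
have -> : re (m (x', y') - m (x, y)) = x' - x by rewrite !ReIm /=; ring.
have -> : im (m (x', y') - m (x, y)) = y' - y by rewrite !ReIm /=; ring.
by move: xx yy; rewrite /ball /= distrC [`|y - _|]distrC; lra.
Qed.

Lemma sphere_compact r : compact [set v | supn v = r].
Proof.
rewrite (_ : [set v | _] = [set v | supn v <= r] `&` supn @^-1` [set r]).
  apply: compact_closedI; first exact: box_compact.
  apply: closed_comp => // v _; exact: continuous_supn.
by apply/seteqP; split=> [v /= ->|v []].
Qed.

Lemma max_principle_box f p q r M :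
  (forall v, supn v <= r -> v != p -> v != q -> cdiff f v) ->
  (forall v, supn v <= r -> {for v, continuous f}) ->
  (forall v, supn v = r -> cabs (f v) <= M) ->
  forall w, supn w <= r -> w != p -> w != q -> cabs (f w) <= M.
Proof.
have [z [zr zi]] : exists z : C, re z = - r /\ im z = - r.
  by exists (Complex (- r) (- r)).
have boxE v : square z (2 * r) v <-> supn v <= r.
  rewrite supn_le !ler_norml /square /mkset zr zi; split.
    by move=> [? ? ? ?]; apply/andP; split; apply/andP; split; lra.
  by move=> /andP[/andP[? ?] /andP[? ?]]; split; lra.
move=> fd fc fM w /boxE wr wp wq.
apply: (@max_principle _ f p q z (2 * r)) => // v; first by move=> /boxE /fd.
  by move=> /boxE /fc.
move=> [/boxE vr vb]; apply: fM; apply/eqP; rewrite eq_le vr /=.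
rewrite le_max !ler_normr; case: vb => ->; rewrite ?zr ?zi ?opprK ?lexx ?orbT//.
- by apply/orP; left; apply/orP; left; lra.
- by apply/orP; right; apply/orP; left; lra.
Qed.

Definition csqrt (u : C) : C :=
  if 0 <= re (sqrtC u) then sqrtC u else - sqrtC u.

Lemma csqrtK u : csqrt u ^+ 2 = u.
Proof. by rewrite /csqrt; case: ifP; rewrite ?sqrrN sqrtCK. Qed.

Lemma re_csqrt u : 0 <= re (csqrt u).
Proof.
rewrite /csqrt; case: ifP => // /negbT; rewrite -ltNge ReIm.
by rewrite oppr_ge0 => /ltW.
Qed.

Lemma csqrt1 : csqrt 1 = 1.
Proof.
have /eqP := csqrtK 1; rewrite sqrf_eq1 => /orP[/eqP//|/eqP E].
by have := re_csqrt 1; rewrite E !ReIm oppr_ge0 ler10.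
Qed.

(** [csqrt] is the branch with non-negative real part; on the open right
    half-plane [csqrt v + csqrt u] stays away from 0, and its inverse is the
    slope. *)
Lemma cdiff_csqrt u : 0 < re u -> cdiff csqrt u.
Proof.
move=> u0; pose a := re (csqrt u).
have a0 : 0 < a.
  rewrite lt0r re_csqrt andbT; apply: contraTneq u0 => az.
  rewrite -[u in re u]csqrtK expr2 ReIm -/a az mulr0 sub0r.
  by rewrite -leNgt oppr_le0 -expr2 sqr_ge0.
have sumE v : (csqrt v - csqrt u) * (csqrt v + csqrt u) = v - u.
  by rewrite -[v in RHS]csqrtK -[u in RHS]csqrtK; ring.
have sum_ge v : a <= cabs (csqrt v + csqrt u).
  apply: le_trans (ler_norm _) _; apply: le_trans (ler_re _).
  by rewrite !ReIm -/a ger0_norm ?(ltW a0)// ger0_norm;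
     have := re_csqrt v; lra.
have sc : {for u, continuous csqrt}.
  apply/continuous_cabsP => e e0; exists (e * a); first exact: mulr_gt0.
  move=> v; rewrite -sumE cabsM => H.
  rewrite -(ltr_pM2r a0); apply: le_lt_trans H.
  by rewrite ler_wpM2l ?cabs_ge0.
have sum_neq0 v : csqrt v + csqrt u != 0.
  by rewrite -cabs_gt0; exact: lt_le_trans (sum_ge v).
exists (csqrt u + csqrt u)^-1, (fun v => (csqrt v + csqrt u)^-1).
split; [|by []|].
  exact: (continuous_atV (continuous_atD sc
    (@continuous_at_cst R (csqrt u) u)) (sum_neq0 u)).
move=> v; rewrite -sumE mulrCA mulVf// mulr1; ring.
Qed.

Lemma re_gt0_near1 u : cabs (u - 1) < 1 -> 0 < re u.
Proof. by move=> /(le_lt_trans (ler_re _)); rewrite !ReIm ltr_norml; lra. Qed.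

(** Uniform continuity on the compact square, in the multiplicative form that
    keeps [F v / F u] in the right half-plane. *)
Lemma uniform_ratio F r : (forall v, supn v <= r -> cdiff F v) ->
  (forall v, supn v <= r -> F v != 0) ->
  exists n : nat, forall u v, supn u <= r -> cabs (v - u) <= 2 * r / n.+1%:R ->
    cabs (F v - F u) < cabs (F u).
Proof.
move=> Fd F0.
have /compact_near_coveringP cov := @box_compact r.
have [|N _ NP] := cov nat \oo (fun n u => forall v,
  cabs (v - u) <= 2 * r / n.+1%:R -> cabs (F v - F u) < cabs (F u)) _.
  move=> u /= ur.
  have e0 : 0 < cabs (F u) / 3 by rewrite divr_gt0// cabs_gt0 F0.
  have [d d0 dP] := (continuous_cabsP _ _).1 (cdiff_continuous (Fd u ur)) _ e0.
  have [N NP] : exists N : nat, `|2 * r / (d / 2)| < N%:R.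
    exists (Num.bound `|2 * r / (d / 2)|); exact: archi_boundP.
  exists ([set v | cabs (v - u) < d / 2], [set n | (N <= n)%N]) => /=.
    split; last by exists N.
    by apply/nbhs_cabsP; exists (d / 2) => //; rewrite divr_gt0.
  move=> [u' n] [/= u'u Nn] v vu'.
  have vu : cabs (v - u) < d.
    rewrite (_ : v - u = (v - u') + (u' - u)); last by ring.
    apply: le_lt_trans (ler_cabsD _ _) _.
    have : 2 * r / n.+1%:R < d / 2.
      rewrite ltr_pdivrMr// [d / 2 * _]mulrC -ltr_pdivrMr ?divr_gt0//.
      apply: le_lt_trans (ler_norm _) _; apply: lt_le_trans NP _.
      by rewrite ler_nat ltnW.
    by move=> /(le_lt_trans vu'); lra.
  have := dP v vu; have /dP : cabs (u' - u) < d by lra.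
  have := ler_cabsB (F v - F u) (F u' - F u).
  rewrite (_ : F v - F u - (F u' - F u) = F v - F u'); last by ring.
  have := lerB_cabs (F u) (F u' - F u).
  rewrite (_ : F u + (F u' - F u) = F u'); last by ring.
  lra.
by exists N => u v ur; apply: (NP N (leqnn N) u ur).
Qed.

(** Moving from 0 to [v] along the segment in [n + 1] equal steps, the ratios of
    consecutive values of [F] lie in the right half-plane, where [csqrt] is
    holomorphic; the root is the product of the roots of these ratios. *)
Lemma holomorphic_sqrt F r : (forall v, supn v <= r -> cdiff F v) ->
  (forall v, supn v <= r -> F v != 0) -> F 0 = 1 ->
  exists h : C -> C, h 0 = 1 /\
    forall v, supn v <= r -> cdiff h v /\ h v ^+ 2 = F v.
Proof.
move=> Fd F0 F1; have [n nP] := uniform_ratio Fd F0.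
pose c k : C := ofR (k%:R / n.+1%:R).
have cr k v : (k <= n.+1)%N -> supn v <= r -> supn (c k * v) <= r.
  move=> kn; apply: le_trans; apply: supn_ofRM.
  by rewrite divr_ge0//= ler_pdivrMr// mul1r ler_nat.
suff : forall k, (k <= n.+1)%N -> exists h : C -> C, h 0 = 1 /\
    forall v, supn v <= r -> cdiff h v /\ h v ^+ 2 = F (c k * v).
  move=> /(_ n.+1 (leqnn _)) [h [h0 hP]]; exists h; split=> // v /hP.
  by rewrite /c divff// [ofR 1]rmorph1 mul1r.
elim=> [_|k IH kn].
  exists (fun=> 1); split=> // v _; split; first exact: cdiff_cst.
  by rewrite /c mul0r [ofR 0]rmorph0 mul0r F1 expr1n.
have [h [h0 hP]] := IH (ltnW kn).
have Fcd j v : (j <= n.+1)%N -> supn v <= r -> cdiff (fun v => F (c j * v)) v.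
  move=> jn vr; apply: (@cdiff_comp _ (fun v => c j * v)); last exact/Fd/cr.
  by apply: cdiffM; [exact: cdiff_cst|exact: cdiff_id].
exists (fun v => h v * csqrt (F (c k.+1 * v) / F (c k * v))); split.
  by rewrite !mulr0 F1 divr1 csqrt1 h0 mulr1.
move=> v vr; have [hd hE] := hP v vr.
have Fk0 : F (c k * v) != 0 by apply/F0/cr => //; exact: ltnW.
split; last by rewrite exprMn csqrtK hE mulrCA divff// mulr1.
apply: cdiffM => //.
apply: (@cdiff_comp _ (fun v => F (c k.+1 * v) / F (c k * v))).
  by apply: cdiff_div => //; apply: Fcd => //; exact: ltnW.
apply: cdiff_csqrt; apply: re_gt0_near1.
rewrite (_ : _ - 1 = (F (c k.+1 * v) - F (c k * v)) / F (c k * v)); last first.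
  by rewrite mulrBl divff.
rewrite cabsM cabsV ltr_pdivrMr ?cabs_gt0// mul1r; apply: nP.
  by apply: cr => //; exact: ltnW.
rewrite -mulrBl cabsM -ofRN -ofRD cabs_ofR -mulrBl -natr1 addrC addKr mul1r.
rewrite ger0_norm// mulrC ler_wpM2r//; apply: le_trans (cabs_supn v) _; lra.
Qed.

End Sqrt.

(** * Rigidity of univalent functions *)

Section Koebe.
Variable R : realType.
Local Notation C := (cplx R).
Implicit Types (f g : C -> C) (u v w z : C) (r rho M : R).

(** Away from [p] the slope is a genuine difference quotient. *)
Lemma cdiff_slope g (s : C -> C) p : (forall v, g v = g p + s v * (v - p)) ->
  forall w, cdiff g w -> w != p -> cdiff s w.
Proof.
move=> gs w gd wp.
have : cdiff (fun v => (g v - g p) / (v - p)) w.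
  apply: cdiff_div; last by rewrite subr_eq0.
    by apply: cdiffB => //; exact: cdiff_cst.
  by apply: cdiffB; [exact: cdiff_id|exact: cdiff_cst].
move=> /cdiff_near; apply.
apply/nbhs_cabsP; exists (cabs (w - p)); first by rewrite cabs_gt0 subr_eq0.
move=> v vw; rewrite (gs v) addrC addKr mulfK// subr_eq0.
by apply: contraTneq vw => ->; rewrite cabsB ltxx.
Qed.

Lemma max_principle_holomorphic f r M : (forall v, supn v <= r -> cdiff f v) ->
  (forall v, supn v = r -> cabs (f v) <= M) ->
  forall w, supn w <= r -> cabs (f w) <= M.
Proof.
move=> fd fM w wr; have pr v : supn v <= r -> v != ofR (`|r| + 1).
  apply: contraTneq => ->; rewrite supn_ofR -ltNge ger0_norm ?addr_ge0//.
  by have := ler_norm r; lra.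
refine (@max_principle_box R f (ofR (`|r| + 1)) (ofR (`|r| + 1)) r _ _ _ fM w wr
  (pr w wr) (pr w wr)).
- by move=> v vr _ _; exact: fd.
- by move=> v /fd /cdiff_continuous.
Qed.

(** The maximum principle for [v / g v], which extends continuously to 0 because
    the derivative there does not vanish. *)
Lemma min_quotient g d r m : 0 < r -> 0 < m ->
  (forall v, supn v <= r -> cdiff g v) ->
  (forall v, supn v <= r -> v != 0 -> g v != 0) ->
  g 0 = 0 -> cderiv g 0 d -> d != 0 ->
  (forall v, supn v = r -> m <= cabs (g v)) ->
  forall w, supn w <= r -> m * cabs w <= 2 * r * cabs (g w).
Proof.
move=> r0 m0 gd gn0 g0 [s [sc sd gs]] d0 gm w wr.
have [->|wn0] := eqVneq w 0; first by rewrite g0 cabs0 !mulr0.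
have gsE v : g v = s v * v by rewrite gs g0 subr0 add0r.
have sn0 v : supn v <= r -> s v != 0.
  move=> vr; have [->|vn0] := eqVneq v 0; first by rewrite sd.
  by have := gn0 v vr vn0; rewrite gsE mulf_eq0 negb_or => /andP[].
have sdiff v : supn v <= r -> v != 0 -> cdiff s v.
  by move=> vr vn0; apply: (cdiff_slope gs) => //; exact: gd.
have scont v : supn v <= r -> {for v, continuous s}.
  move=> vr; have [->|vn0] := eqVneq v 0; first exact: sc.
  by apply: cdiff_continuous; exact: sdiff.
have : cabs (s w)^-1 <= 2 * r / m.
  refine (@max_principle_box R (fun v => (s v)^-1) 0 0 r _ _ _ _ w wr wn0 wn0).
  - by move=> v vr v0 _; apply: cdiffV; [exact: sdiff|exact: sn0].
  - by move=> v vr; apply: continuous_atV; [exact: scont|exact: sn0].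
  - move=> v vr; rewrite cabsV.
    have sv : 0 < cabs (s v) by rewrite cabs_gt0 sn0// vr.
    rewrite -[_^-1]mul1r ler_pdivrMr// mulrAC ler_pdivlMr// mul1r.
    apply: le_trans (gm v vr) _; rewrite gsE cabsM mulrC ler_wpM2r ?cabs_ge0//.
    by rewrite (le_trans (cabs_supn v))// vr.
have sw : 0 < cabs (s w) by rewrite cabs_gt0 sn0.
rewrite cabsV -[_^-1]mul1r ler_pdivrMr// mulrAC ler_pdivlMr// mul1r => H.
by rewrite gsE cabsM mulrA ler_wpM2r ?cabs_ge0.
Qed.

Lemma schwarz k r M : 0 < r -> (forall v, supn v <= r -> cdiff k v) ->
  (forall v, supn v <= r -> cabs (k v) <= M) ->
  forall w, supn w <= r -> cabs (k w - k 0) <= (2 * M / r) * cabs w.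
Proof.
move=> r0 kd kM w wr.
have [->|wn0] := eqVneq w 0; first by rewrite subrr cabs0 mulr0.
have [d [s [sc sd ks]]] : cdiff k 0 by apply: kd; rewrite supn0 ltW.
have ksE v : k v - k 0 = s v * v by rewrite (ks v) addrC addKr subr0.
have sdiff v : supn v <= r -> v != 0 -> cdiff s v.
  by move=> vr vn0; apply: (cdiff_slope ks) => //; exact: kd.
rewrite ksE cabsM ler_wpM2r ?cabs_ge0//.
refine (@max_principle_box R s 0 0 r _ _ _ _ w wr wn0 wn0).
- by move=> v vr v0 _; exact: sdiff.
- move=> v vr; have [->|vn0] := eqVneq v 0; first exact: sc.
  by apply: cdiff_continuous; exact: sdiff.
- move=> v vr; have v0 : 0 < cabs v by rewrite (lt_le_trans _ (supn_cabs v))// vr.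
  rewrite ler_pdivlMr// -(@ler_pM2r _ 1)// !mulr1.
  apply: (@le_trans _ _ (cabs (s v) * cabs v)).
    by rewrite ler_wpM2l ?cabs_ge0// -vr supn_cabs.
  rewrite -cabsM -ksE; apply: le_trans (ler_cabsB _ _) _.
  have := kM v; rewrite vr lexx => /(_ isT).
  have := kM 0; rewrite supn0 (ltW r0) => /(_ isT); lra.
Qed.

(** A value [b] close to the centre is taken: otherwise [1 / (h - b)] would be
    holomorphic and larger at 0 than on the boundary. *)
Lemma surj_near_center h r c rho : 0 < r -> (forall v, supn v <= r -> cdiff h v) ->
  h 0 = c -> (forall v, supn v = r -> 2 * rho <= cabs (h v - c)) ->
  forall b, cabs (b - c) < rho -> exists2 w, supn w <= r & h w = b.
Proof.
move=> r0 hd h0 hb b bc; have rho0 : 0 < rho := le_lt_trans (cabs_ge0 _) bc.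
apply: contrapT => nob.
have hn v : supn v <= r -> h v - b != 0.
  by move=> vr; apply/negP; rewrite subr_eq0 => /eqP hv; apply: nob; exists v.
have hbd v : supn v <= r -> cdiff (fun v => h v - b) v.
  by move=> vr; apply: cdiffB; [exact: hd|exact: cdiff_cst].
have : cabs (h 0 - b)^-1 <= rho^-1.
  refine (@max_principle_holomorphic (fun v => (h v - b)^-1) r _ _ _ 0 _).
  - by move=> v vr; apply: cdiffV; [exact: hbd|exact: hn].
  - move=> v vr; have vn : 0 < cabs (h v - b) by rewrite cabs_gt0 hn// vr.
    rewrite cabsV lef_pV2 ?posrE//.
    have := hb v vr; have := ler_cabsB (h v - b) (c - b).
    rewrite (_ : h v - b - (c - b) = h v - c); last by ring.
    by rewrite [cabs (c - b)]cabsB; lra.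
  - by rewrite supn0 ltW.
rewrite h0 cabsV cabsB lef_pV2 ?posrE//; first by rewrite leNgt bc.
by rewrite cabsB -h0 cabs_gt0 hn// supn0 ltW.
Qed.

(** The weak Koebe theorem; [m] is the least modulus of [g] on the boundary.
    The first bound is [min_quotient]; the second one comes from the square root
    of [1 - g / a], [a] being a boundary value of modulus [m]. *)
Lemma univalent_bound g d r : 0 < r ->
  (forall v, supn v <= r -> cdiff g v) ->
  (forall v w, supn v <= r -> supn w <= r -> g v = g w -> v = w) ->
  g 0 = 0 -> cderiv g 0 d -> d != 0 ->
  exists2 m, 0 < m & forall w, supn w <= r -> m * cabs w <= 2 * r * cabs (g w) /\
    (supn w <= r / 600 -> cabs (g w) <= 26 * m).
Proof.
move=> r0 gd gi g0 gd0 d0.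
have r_neq0 : r != 0 by rewrite gt_eqF.
have gn0 v : supn v <= r -> v != 0 -> g v != 0.
  move=> vr; apply: contra => /eqP gv; apply/eqP; apply: gi => //.
    by rewrite supn0 ltW.
  by rewrite gv g0.
have [w1 w1r w1min] : exists2 w1, supn w1 = r &
    forall v, supn v = r -> cabs (g w1) <= cabs (g v).
  have ne : [set v : C | supn v = r] !=set0.
    by exists (ofR r); rewrite /= supn_ofR gtr0_norm.
  have [|w1 /set_mem /= w1r H] := @compact_EVT_min _ _ (fun v => cabs (g v)) _ ne
    (@sphere_compact R r).
    apply: continuous_in_subspaceT => v /set_mem /= vr.
    apply: (@continuous_comp _ _ _ g (@cabs R)); last exact: continuous_cabs.
    by apply: cdiff_continuous; apply: gd; rewrite vr.
  by exists w1 => // v vr; apply: H; apply/mem_set.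
have w1n0 : w1 != 0 by rewrite -cabs_gt0 (lt_le_trans _ (supn_cabs _))// w1r.
pose a := g w1; pose m := cabs a.
have a0 : a != 0 by apply: gn0 => //; rewrite w1r.
have m0 : 0 < m by rewrite cabs_gt0.
have mq := min_quotient r0 m0 gd gn0 g0 gd0 d0 w1min.
exists m => // w wr; split; first exact: mq.
pose t := r / 2; have t0 : 0 < t by rewrite divr_gt0.
have tr v : supn v <= t -> supn v <= r by rewrite /t; lra.
pose F v := 1 - g v / a.
have Fd v : supn v <= t -> cdiff F v.
  move=> /tr vr; apply: cdiffB; first exact: cdiff_cst.
  by apply: cdiffM; [exact: gd|exact: cdiff_cst].
have Fn0 v : supn v <= t -> F v != 0.
  move=> vt; rewrite /F subr_eq0 eq_sym; apply/negP => /eqP E.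
  have /gi vw1 : g v = a by rewrite -[RHS]mul1r -E divfK.
  have vE : v = w1 by apply: vw1; rewrite ?w1r// tr.
  by move: vt; rewrite vE w1r /t; lra.
have F1 : F 0 = 1 by rewrite /F g0 mul0r subr0.
have [h [h0 hP]] := holomorphic_sqrt Fd Fn0 F1.
have hsq v : supn v <= t -> (h v - 1) * (h v + 1) = - (g v / a).
  by move=> /hP[_ hE]; rewrite -[RHS](addKr 1) -/(F v) -hE; ring.
(* On the boundary [g / a] has modulus at least 1/4, too much for a product of
   [h v - 1] and [h v + 1] if [h v] is within 1/9 of 1. *)
have hb v : supn v = t -> 2 * (1 / 18) <= cabs (h v - 1).
  move=> vt; rewrite leNgt; apply/negP => hv.
  have vt' : supn v <= t by rewrite vt.
  have : 1 / 4 <= cabs (h v - 1) * cabs (h v + 1).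
    rewrite -cabsM hsq// cabsN cabsM cabsV -/m ler_pdivlMr//.
    have := mq v (tr _ vt'); have := supn_cabs v; rewrite vt /t => H1 H2.
    have H3 : m * (r / 2) <= 2 * r * cabs (g v).
      by apply: le_trans H2; rewrite ler_wpM2l// ltW.
    rewrite -(@ler_pM2l _ (2 * r)) ?mulr_gt0//; lra.
  have : cabs (h v + 1) < 19 / 9.
    rewrite (_ : h v + 1 = (h v - 1) + (1 + 1)); last by ring.
    apply: le_lt_trans (ler_cabsD _ _) _.
    by have := ler_cabsD (1 : C) 1; rewrite !cabs1; lra.
  move=> H1 H2; have : cabs (h v - 1) * cabs (h v + 1) <= 2 * (1/18) * (19 / 9).
    by apply: ler_pM; rewrite ?cabs_ge0// ltW.
  by lra.
have hsurj := surj_near_center t0 (fun v vt => (hP v vt).1) h0 hb.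
(* If [h v] were that close to -1, then [- h v] would be a value [h v'] with
   [g v' = g v]. *)
have omit v : supn v <= t -> 1 / 18 <= cabs (h v + 1).
  move=> vt; rewrite leNgt; apply/negP => hv.
  have [|v' vt' hv'] := hsurj (- h v).
    by rewrite -opprD cabsN.
  have gE : g v = g v'.
    have := hsq v' vt'; rewrite hv' (_ : (- h v - 1) * (- h v + 1) =
      (h v - 1) * (h v + 1)); last by ring.
    by rewrite hsq// => /oppr_inj /(mulIf (invr_neq0 a0)).
  have vv : v = v' by apply: gi => //; exact: tr.
  have hv0 : h v = 0.
    apply/eqP; have /eqP := hv'; rewrite -vv -addr_eq0.
    by rewrite -mulr2n mulrn_eq0.
  by move: hv; rewrite hv0 add0r cabs1; lra.
have h1n0 v : supn v <= t -> h v + 1 != 0.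
  by move=> /omit H; rewrite -cabs_gt0; lra.
have h1d v : supn v <= t -> cdiff (fun v => (h v + 1)^-1) v.
  move=> vt; apply: cdiffV; last exact: h1n0.
  by apply: cdiffD; [exact: (hP v vt).1|exact: cdiff_cst].
have kb v : supn v <= t -> cabs (h v + 1)^-1 <= 18.
  move=> vt; rewrite cabsV -[18]invrK lef_pV2 ?posrE ?invr_gt0//.
    by have := omit v vt; lra.
  by rewrite cabs_gt0 h1n0.
move=> w600; have wt : supn w <= t by rewrite /t; lra.
have := schwarz t0 h1d kb wt; rewrite h0 => kw.
(* The inverse of [h + 1] is 1/2 at 0 and moves by at most 6/25 on the square
   of radius [r / 600]. *)
have kge : 1 / 4 <= cabs (h w + 1)^-1.
  have : 2 * 18 / t * cabs w <= 6 / 25.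
    rewrite mulrAC ler_pdivrMr// /t.
    by have := cabs_supn w; lra.
  have := ler_cabsB (h w + 1)^-1 ((h w + 1)^-1 - (1 + 1)^-1).
  rewrite opprB addrC subrK cabsV (_ : 1 + 1 = ofR 2); last first.
    by rewrite /ofR rmorph_nat.
  rewrite cabs_ofR ger0_norm//; move: kw; rewrite (_ : 1 + 1 = ofR 2); last first.
    by rewrite /ofR rmorph_nat.
  lra.
have hw4 : cabs (h w + 1) <= 4.
  move: kge; rewrite cabsV ler_pdivrMr//; rewrite ler_pdivlMl ?cabs_gt0 ?h1n0//.
  lra.
have : cabs ((h w - 1) * (h w + 1)) <= 6 * 4.
  rewrite cabsM; apply: ler_pM; rewrite ?cabs_ge0//.
  rewrite (_ : h w - 1 = (h w + 1) - ofR 2); last first.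
    by rewrite /ofR rmorph_nat; ring.
  apply: le_trans (ler_cabsB _ _) _; rewrite cabs_ofR ger0_norm//; lra.
rewrite hsq// cabsN cabsM cabsV -/m ler_pdivrMr//.
lra.
Qed.

(** A function that is univalent on a square [K] times larger and fixes 0 and 1
    is nearly the identity: the bound tends to 0 as [t] grows while [w] stays
    bounded. *)
Lemma univalent_rigidity : exists2 K : R, 1 <= K & forall g d t, 2 <= t ->
  (forall v, supn v <= K * t -> cdiff g v) ->
  (forall v w, supn v <= K * t -> supn w <= K * t -> g v = g w -> v = w) ->
  g 0 = 0 -> g 1 = 1 -> cderiv g 0 d -> d != 0 ->
  forall w, supn w <= t -> cabs (g w - w) <= cabs w * cabs (w - 1) * (K / (t - 1)).
Proof.
(* On the boundary of the square of radius [t], with [r = 600 * t], the modulus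
   of [g v] is at most [26 * m <= 52 * r], hence that of [g v / v] at most
   [52 * 600]; 1 is added on subtracting [g 1 / 1]. *)
exists (52 * 600 + 1); first by lra.
move=> g d t t2 gd' gi' g0 g1 gd0 d0.
have [r rK rE] : exists2 r, r <= (52 * 600 + 1) * t & r = 600 * t.
  by exists (600 * t) => //; lra.
have gd v : supn v <= r -> cdiff g v by move=> vr; apply/gd'/(le_trans vr).
have gi v w : supn v <= r -> supn w <= r -> g v = g w -> v = w.
  by move=> vr wr; apply: gi'; [exact: le_trans vr rK|exact: le_trans wr rK].
have tE : t = r / 600 by rewrite rE; lra.
have r0 : 0 < r by lra.
have tr v : supn v <= t -> supn v <= r by move=> H; lra.
have [m m0 mP] := univalent_bound r0 gd gi g0 gd0 d0.
have m2r : m <= 2 * r.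
  by have := (mP 1 _).1; rewrite supn1 cabs1 g1 cabs1 !mulr1; apply; lra.
have [s [sc sd gs]] := gd0.
have gsE v : g v = s v * v by rewrite gs g0 subr0 add0r.
have s1 : s 1 = 1 by have := gsE 1; rewrite g1 mulr1.
have sdiff v : supn v <= t -> v != 0 -> cdiff s v.
  by move=> vr vn0; apply: (cdiff_slope gs) => //; apply/gd/tr.
have [e [q [qc qe sq]]] : cdiff s 1.
  by apply: sdiff; rewrite ?oner_neq0// supn1; lra.
have qdiff v : supn v <= t -> v != 0 -> v != 1 -> cdiff q v.
  by move=> vr vn0 vn1; apply: (cdiff_slope sq) => //; exact: sdiff.
have sqE v : s v - 1 = q v * (v - 1) by rewrite sq s1 addrC addKr.
have scont v : supn v <= t -> {for v, continuous s}.
  move=> vr; have [->|vn0] := eqVneq v 0; first exact: sc.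
  by apply: cdiff_continuous; exact: sdiff.
have q0c : {for 0, continuous q}.
  have cc : {for 0, continuous (fun v => (s v - 1) / (v - 1))}.
    apply: continuous_atM.
      by apply: (continuous_atD sc); exact: continuous_at_cst.
    apply: continuous_atV; last by rewrite sub0r oppr_eq0 oner_neq0.
    by apply: continuous_atD; [exact: continuous_at_id|exact: continuous_at_cst].
  apply: (continuous_near cc); apply/nbhs_cabsP; exists 1 => // v.
  rewrite subr0 => v1; rewrite sqE mulfK// subr_eq0.
  by apply: contraTneq v1 => ->; rewrite cabs1 ltxx.
move=> w wt.
rewrite (_ : g w - w = w * (w - 1) * q w); last first.
  rewrite gsE (_ : s w * w - w = w * (s w - 1)); last by ring.
  by rewrite sqE; ring.
have [->|wn0] := eqVneq w 0; first by rewrite !mul0r cabs0 !mul0r.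
have [->|wn1] := eqVneq w 1; first by rewrite subrr mulr0 mul0r cabs0 mulr0 mul0r.
rewrite !cabsM ler_wpM2l// ?mulr_ge0 ?cabs_ge0//.
refine (@max_principle_box R q 0 1 t _ _ _ _ w wt wn0 wn1); first exact: qdiff.
  move=> v vt; have [->|vn0] := eqVneq v 0; first exact: q0c.
  have [->|vn1] := eqVneq v 1; first exact: qc.
  by apply: cdiff_continuous; exact: qdiff.
move=> v vt; rewrite ler_pdivlMr; last by lra.
have vt' : supn v <= t by rewrite vt.
have v1 : t - 1 <= cabs (v - 1).
  by have := lerB_cabs v (-1); rewrite cabsN cabs1; have := supn_cabs v; rewrite vt; lra.
apply: (@le_trans _ _ (cabs (q v) * cabs (v - 1))).
  by rewrite ler_wpM2l ?cabs_ge0.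
rewrite -cabsM -sqE; apply: le_trans (ler_cabsB _ _) _; rewrite cabs1.
have v0 : 0 < cabs v by apply: lt_le_trans (supn_cabs v); rewrite vt; lra.
suff : cabs (s v) <= 52 * 600 by lra.
rewrite -(@ler_pM2r _ (cabs v))// -cabsM -gsE.
have [_] := mP v (tr _ vt'); rewrite -tE => /(_ vt').
have := supn_cabs v; rewrite vt; lra.
Qed.

End Koebe.

(** * Derivatives of sphere-valued functions *)

Section SphereCalculus.
Variable R : realType.
Local Notation C := (cplx R).
Local Notation S := (sphere R).

Lemma sphere_coordK_near (c : S) :
  \forall x \near c, sphere_coord_inv c (sphere_coord c x) = x.
Proof.
case: c => [b|].
  by change (nbhs b (fun v : C => Some v = Some v)); apply: filterE.
(* At infinity the coordinate has its junk value at 0, which is cut out. *)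
exists [set (0 : C)].
  split; first exact: compact_set1.
  apply: accessible_closed_set1; apply: hausdorff_accessible.
  exact: norm_hausdorff.
move=> _ [[v /= v0 <-]|->] /=; last by rewrite invr0 eqxx.
by move/eqP: v0 => v0; rewrite invr_eq0 (negbTE v0) invrK.
Qed.

(** The derivative of a sphere-valued function, read in the standard coordinate
    around its value. *)
Definition sderiv (h : C -> S) (w d : C) :=
  {for w, continuous h} /\ cderiv (fun v => sphere_coord (h w) (h v)) w d.

Lemma sderiv_near (h k : C -> S) w d : sderiv h w d ->
  (\forall v \near w, h v = k v) -> sderiv k w d.
Proof.
move=> [hc hd] hk; have hw : h w = k w by exact: nbhs_singleton hk.
split; first exact: continuous_near hk.
apply: (cderiv_near hd); rewrite -hw; apply: filterS hk => v ->.
by [].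
Qed.

(** The chain rule, without continuity of [g]: it applies to [f] at infinity,
    where only the derivative of the local representation is known. *)
Lemma cderiv_local_rep (h : C -> S) (g : S -> S) w d d' : sderiv h w d ->
  cderiv (local_rep g (h w)) (sphere_coord (h w) (h w)) d' ->
  cderiv (fun v => sphere_coord (g (h w)) (g (h v))) w (d' * d).
Proof.
move=> [hc hd] gd; have := cderiv_comp hd gd => /cderiv_near; apply.
have : \forall v \near w, sphere_coord_inv (h w) (sphere_coord (h w) (h v)) = h v.
  exact: hc (sphere_coordK_near (h w)).
by apply: filterS => v hv; rewrite /local_rep /= hv.
Qed.

Lemma sderiv_finite_part (h : C -> S) w d b : h w = Some b -> sderiv h w d ->
  cderiv (fun v => finite_part (h v)) w d.
Proof. by move=> hw [_]; rewrite hw. Qed.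

Lemma sderiv_Some (w : C) : sderiv (Some : C -> S) w 1.
Proof.
split; last exact: cderiv_id.
exact: one_point_compactification_some_continuous.
Qed.

Lemma complex_diff_sderiv (g : S -> S) (h : C -> S) w d : sderiv h w d ->
  complex_diff_at g (h w) -> exists d', sderiv (g \o h) w (d' * d).
Proof.
move=> hd [gc gd]; have [d' gd'] := derivable_cdiff gd; exists d'; split.
  exact: (continuous_comp hd.1 gc).
exact: cderiv_local_rep gd'.
Qed.

End SphereCalculus.

(** * Late projections of a leaf *)

Section Charts.
Variables (R : realType) (f : sphere R -> sphere R).
Local Notation C := (cplx R).
Local Notation S := (sphere R).
Implicit Types (x y : leaf_space f) (U : set S).

Lemma orbitS x n : f (orbit_of x n.+1) = orbit_of x n.
Proof. by have [H _] : regular_set f (set_val x) := set_valP x; exact: H. Qed.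

Lemma orbit_iter x n : iter n f (orbit_of x n) = orbit_of x 0%N.
Proof. by elim: n => [//|n IH]; rewrite iterSr orbitS. Qed.

Lemma orbit_eq_le x y m n : (m <= n)%N -> orbit_of x n = orbit_of y n ->
  orbit_of x m = orbit_of y m.
Proof.
move=> mn; rewrite -(subnK mn); elim: (n - m)%N => [//|k IH].
by rewrite addSn => H; apply: IH; rewrite -(orbitS x) -(orbitS y) H.
Qed.

Lemma orbit_inj x y : (forall n, orbit_of x n = orbit_of y n) -> x = y.
Proof. by move=> H; apply: val_inj; apply/funext => n; exact: H. Qed.

Lemma basic_nbhd_refl U x : U (orbit_of x 0%N) -> basic_nbhd U (orbit_of x) x.
Proof.
by move=> Ux n; apply: connected_component_refl; rewrite /preimage/= orbit_iter.
Qed.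

(** A basic neighbourhood is a neighbourhood of the same kind, with the same
    [U] and the same index [N], of each of its points. *)
Lemma basic_nbhd_chart U x y N : open_nbhs (orbit_of x 0%N) U ->
  univalent_from f U (orbit_of x) N -> basic_nbhd U (orbit_of x) y ->
  open_nbhs (orbit_of y 0%N) U /\ univalent_from f U (orbit_of y) N.
Proof.
move=> [Uo Ux] Ui yU; split.
  by split=> //; exact: (connected_component_sub (yU 0%N)).
move=> n Nn a b /set_mem ya /set_mem yb; apply: (Ui n Nn); apply/mem_set;
  exact: connected_component_trans (yU n.+1) _.
Qed.

Lemma basic_nbhd_nbhs U x N : open_nbhs (orbit_of x 0%N) U ->
  univalent_from f U (orbit_of x) N -> nbhs x (basic_nbhd U (orbit_of x)).
Proof.
move=> Ux Ui; exists (basic_nbhd U (orbit_of x)); split=> //.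
  move=> y yU; have [Uy Uyi] := basic_nbhd_chart Ux Ui yU.
  exists U; split=> //; first by exists N.
  by move=> y' y'U n; exact: connected_component_trans (yU n) (y'U n).
by apply: basic_nbhd_refl; case: Ux.
Qed.

Lemma univalent_fromW U x N n : (N <= n)%N ->
  univalent_from f U (orbit_of x) N -> univalent_from f U (orbit_of x) n.
Proof. by move=> Nn Ui m ml; apply: Ui; exact: leq_trans ml. Qed.

(** From index [N] on [f] is injective on the pullbacks, so one late coordinate
    determines the following ones; the preceding ones are its images. *)
Lemma basic_nbhd_inj U x y y' N n : univalent_from f U (orbit_of x) N ->
  (N <= n)%N -> basic_nbhd U (orbit_of x) y -> basic_nbhd U (orbit_of x) y' ->
  orbit_of y n = orbit_of y' n -> y = y'.
Proof.
move=> Ui Nn yU y'U E.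
have up k : orbit_of y (k + n)%N = orbit_of y' (k + n)%N.
  elim: k => [//|k IH]; apply: (Ui (k + n)%N).
  - exact: leq_trans Nn (leq_addl _ _).
  - exact/mem_set/(yU (k + n).+1).
  - exact/mem_set/(y'U (k + n).+1).
  - by rewrite !orbitS.
apply: orbit_inj => k; apply: (@orbit_eq_le _ _ _ (k + n)%N) => //.
exact: leq_addr.
Qed.

Variables (z : leaf_space f) (phi : leaf_space f -> C) (psi : C -> leaf_space f).
Hypothesis psi_leaf : forall v, leaf z (psi v).
Hypothesis psiK : cancel psi phi.
Hypothesis phi_hol : holomorphic_on (leaf_atlas f) (plane_atlas R) (leaf z) phi.
Hypothesis psi_hol : holomorphic_on (plane_atlas R) (leaf_atlas f) [set: C] psi.

(** The projection to the [n]-th coordinate, read in the plane through [psi]. *)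
Definition proj n v : S := orbit_of (psi v) n.

(** In a late chart the projection is inverse to [phi], so the chain rule makes
    its derivative invertible. *)
Lemma proj_sderiv U N n w : open_nbhs (orbit_of (psi w) 0%N) U ->
  univalent_from f U (orbit_of (psi w)) N -> (N <= n)%N ->
  exists2 d, d != 0 & sderiv (proj n) w d.
Proof.
move=> Ux Ui Nn; have Uin := univalent_fromW Nn Ui.
have ch : leaf_atlas f (basic_nbhd U (orbit_of (psi w)), fun y => orbit_of y n).
  by exists (psi w), U, n.
have xU : basic_nbhd U (orbit_of (psi w)) (psi w).
  by apply: basic_nbhd_refl; case: Ux.
have [psic /(_ _ _ _ _ erefl ch I xU)[g [gd gE]]] := psi_hol (I : [set: C] w).
have [d' /sderiv_near pd] := complex_diff_sderiv (sderiv_Some w) gd.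
have {pd} pd : sderiv (proj n) w (d' * 1).
  by apply: pd; apply: filterS gE => v; rewrite /proj /= => ->.
exists (d' * 1) => //.
have [phic /(_ _ _ _ _ ch erefl xU I)[g2 [g2d g2E]]] := phi_hol (psi_leaf w).
have [d2 d2d] := complex_diff_sderiv pd g2d.
have gid : \forall v \near w, (g2 \o proj n) v = Some v.
  have H : \forall v \near w, Some (phi (psi v)) = g2 (orbit_of (psi v) n).
    exact: psic _ g2E.
  by apply: filterS H => v /= <-; rewrite psiK.
have [_ /= one] := sderiv_near d2d gid.
have := cderiv_unique one (cderiv_id w) => E.
by apply: contra_eq_neq E => ->; rewrite mulr0 eq_sym oner_neq0.
Qed.

Hypothesis infty_crit : critical_point f (infty R).

(** The derivative of projection [n] is that of [f] at projection [n+1] times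
    that of projection [n+1].  It does not vanish, whereas the first factor would
    be 0 at infinity. *)
Lemma proj_finite n w d d' : sderiv (proj n) w d -> d != 0 ->
  sderiv (proj n.+1) w d' -> proj n.+1 w <> infty R.
Proof.
move=> [_ pd] d0 pd' pinf.
have fd : cderiv (local_rep f (proj n.+1 w))
    (sphere_coord (proj n.+1 w) (proj n.+1 w)) 0.
  by rewrite pinf; exact: is_derive_cderiv.
have := cderiv_local_rep pd' fd.
have -> : (fun v => sphere_coord (f (proj n.+1 w)) (f (proj n.+1 v))) =
    fun v => sphere_coord (proj n w) (proj n v).
  by apply/funext => v; rewrite /proj !orbitS.
rewrite mul0r => H.
by have := cderiv_unique pd H; move/eqP: d0.
Qed.

Lemma proj_local (w : C) : exists N, exists2 O : set C, nbhs w O & forall n, (N <= n)%N ->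
  (forall u v, O u -> O v -> proj n u = proj n v -> u = v) /\
  (forall v, O v -> proj n v <> infty R /\
    exists2 d, d != 0 & cderiv (fun v => finite_part (proj n v)) v d).
Proof.
have [_ [U [Ux [N Ui]]]] : regular_set f (set_val (psi w)) := set_valP (psi w).
pose O := psi @^-1` basic_nbhd U (orbit_of (psi w)).
exists N.+1; exists O.
  have [psic _] := psi_hol (I : [set: C] w).
  exact: psic (basic_nbhd_nbhs Ux Ui).
case=> [//|n] Nn; split=> [u v Ou Ov E|v Ov].
  have : psi u = psi v by exact: (basic_nbhd_inj Ui (ltnW Nn) Ou Ov).
  by move=> /(congr1 phi); rewrite !psiK.
have [Uv Uvi] := basic_nbhd_chart Ux Ui Ov.
have [d d0 pd] := proj_sderiv Uv Uvi (Nn : (N <= n)%N).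
have [d' d'0 pd'] := proj_sderiv Uv Uvi (ltnW Nn : (N <= n.+1)%N).
have fin := proj_finite pd d0 pd'; split=> //; exists d' => //.
case E : (proj n.+1 v) fin => [b|]; last by case.
by move=> _; exact: sderiv_finite_part E pd'.
Qed.

Lemma proj_box r : \forall n \near \oo,
  (forall u v, supn u <= r -> supn v <= r -> proj n u = proj n v -> u = v) /\
  (forall v, supn v <= r -> proj n v <> infty R /\
    exists2 d, d != 0 & cderiv (fun v => finite_part (proj n v)) v d).
Proof.
have cb := @box_compact R r.
have fin : \forall n \near \oo, [set v | supn v <= r] `<=` fun v =>
    proj n v <> infty R /\
    exists2 d, d != 0 & cderiv (fun v => finite_part (proj n v)) v d.
  move/compact_near_coveringP: cb; apply => w _.
  have [N [V wV NV]] := proj_local w.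
  exists (V, [set n | (N <= n)%N]) => /=; first by split=> //; exists N.
  by move=> [v n] [/= Ov Nn]; exact: (NV n Nn).2.
have inj : \forall n \near \oo,
    [set v | supn v <= r] `*` [set v | supn v <= r] `<=` fun p : C * C =>
    proj n p.1 = proj n p.2 -> p.1 = p.2.
  have /compact_near_coveringP := compact_setX cb cb; apply => -[u v] _.
  have [Nu [Vu uV NVu]] := proj_local u; have [Nv [Vv vV NVv]] := proj_local v.
  have [uv|/eqP uv] := eqVneq u v.
    rewrite -uv in vV *; exists (Vu `*` Vu, [set n | (Nu <= n)%N]) => /=.
      by split; [exists (Vu, Vu)|exists Nu].
    by move=> [[u' v'] n] [/= [? ?] Nn]; apply: (NVu n Nn).1.
  have [k kP] : exists k, proj k u <> proj k v.
    apply: contrapT => H; apply: uv; rewrite -(psiK u) -(psiK v).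
    congr phi; apply: orbit_inj => n; apply: contrapT => Hn.
    by apply: H; exists n.
  (* From [n0] on both projections are finite and stay distinct. *)
  pose n0 := maxn k (maxn Nu Nv).
  have n0P : proj n0 u <> proj n0 v.
    by move=> /(orbit_eq_le (leq_maxl _ _)).
  have [fu [du _ cu]] :=
    (NVu n0 (leq_trans (leq_maxl Nu Nv) (leq_maxr k _))).2 u (nbhs_singleton uV).
  have [fv [dv _ cv]] :=
    (NVv n0 (leq_trans (leq_maxr Nu Nv) (leq_maxr k _))).2 v (nbhs_singleton vV).
  have ne : 0 < cabs (finite_part (proj n0 u) - finite_part (proj n0 v)) / 2.
    rewrite divr_gt0// cabs_gt0 subr_eq0; apply/eqP.
    move: fu fv n0P; case: (proj n0 u) => [a|]//; case: (proj n0 v) => [b|]//.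
    by move=> _ _ H /= E; apply: H; rewrite E.
  have [a a0 aP] := (continuous_cabsP _ _).1 (cderiv_continuous cu) _ ne.
  have [b b0 bP] := (continuous_cabsP _ _).1 (cderiv_continuous cv) _ ne.
  exists ([set u' | cabs (u' - u) < a] `*` [set v' | cabs (v' - v) < b],
    [set n | (n0 <= n)%N]) => /=.
    split; last by exists n0.
    by exists ([set u' | cabs (u' - u) < a], [set v' | cabs (v' - v) < b]) => //=;
      split; apply/nbhs_cabsP; [exists a|exists b].
  move=> [[u' v'] n] [/= [/aP + /bP +] Nn] E.
  have -> : proj n0 u' = proj n0 v' by exact: orbit_eq_le E.
  have := ler_cabsB (finite_part (proj n0 v') - finite_part (proj n0 v))
     (finite_part (proj n0 v') - finite_part (proj n0 u)).
  rewrite (_ : _ - _ = finite_part (proj n0 u) - finite_part (proj n0 v));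
    last by ring.
  by clear -a0 => H1 H2 H3; exfalso; lra.
apply: filterS2 fin inj => n fn jn.
by split=> [u v ur vr|v]; [exact: (jn (u, v))|exact: fn].
Qed.

(** For large [n] the normalised projection is univalent on a square so large
    that [univalent_rigidity] makes its distance to the identity less than [e]. *)
Lemma proj_normalised (r e : R) : 0 < e -> \forall n \near \oo,
  forall w, supn w <= r -> proj n w <> infty R /\
    finite_part (proj n 1) != finite_part (proj n 0) /\
    cabs ((finite_part (proj n w) - finite_part (proj n 0)) /
        (finite_part (proj n 1) - finite_part (proj n 0)) - w) < e.
Proof.
move=> e0; pose rr : R := Num.max r 1.
have [r1 rr1] : r <= rr /\ 1 <= rr by rewrite !le_max !lexx orbT.
have [K K1 rigid] := univalent_rigidity R.
(* [c] bounds the numerator of the estimate when [supn w <= r]. *)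
have [c [c0 cE]] : exists c : R, 0 < c /\ c = 2 * rr * (2 * rr + 1) * K.
  exists (2 * rr * (2 * rr + 1) * K); split=> //.
  by apply: mulr_gt0; [apply: mulr_gt0; lra|lra].
pose t : R := Num.max (Num.max 2 rr) (2 * c / e + 2).
have [t2 tr tc] : [/\ 2 <= t, rr <= t & 2 * c / e + 2 <= t].
  have H1 : Num.max 2 rr <= t by rewrite le_max lexx.
  have H2 : 2 <= Num.max 2 rr by rewrite le_max lexx.
  have H3 : rr <= Num.max 2 rr by rewrite le_max lexx orbT.
  have H4 : 2 * c / e + 2 <= t by rewrite le_max lexx orbT.
  by split=> //; [exact: le_trans H1|exact: le_trans H1].
apply: filterS (proj_box (K * t)) => n [inj fin] w wr.
have tt : t <= K * t by rewrite ler_peMl; lra.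
have box0 : supn (0 : C) <= K * t by rewrite supn0; lra.
have box1 : supn (1 : C) <= K * t by rewrite supn1; lra.
split; first by apply: (fin w _).1; lra.
pose p v := finite_part (proj n v).
have finE v : supn v <= K * t -> proj n v = Some (p v).
  by move=> /fin[+ _]; rewrite /p; case: (proj n v).
have pinj u v : supn u <= K * t -> supn v <= K * t -> p u = p v -> u = v.
  by move=> ur vr E; apply: inj => //; rewrite !finE// E.
have p10 : p 1 != p 0.
  by apply/negP => /eqP /(pinj _ _ box1 box0)/eqP; rewrite oner_eq0.
split=> //; rewrite -/(p 1) -/(p 0) -/(p w).
pose al := (p 1 - p 0)^-1.
have al0 : al != 0 by rewrite invr_eq0 subr_eq0.
pose g v := (p v - p 0) / (p 1 - p 0).
have [d d0 pd] := (fin 0 box0).2.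
have gd : cderiv g 0 (d * al).
  case: pd => s [sc s0 ps]; exists (fun v => s v * al); split.
  - exact: (continuous_atM sc (@continuous_at_cst R al 0)).
  - by rewrite s0.
  - move=> v; rewrite /g -/al -/(p v) (_ : p v = p 0 + s v * (v - 0)); last exact: ps.
    ring.
have gdiff v : supn v <= K * t -> cdiff g v.
  move=> vr; apply: cdiffM; last exact: cdiff_cst.
  apply: cdiffB; last exact: cdiff_cst.
  by have [dv _ ?] := (fin v vr).2; exists dv.
have ginj u v : supn u <= K * t -> supn v <= K * t -> g u = g v -> u = v.
  move=> ur vr /(mulIf al0) /addIr; exact: pinj.
have g0 : g 0 = 0 by rewrite /g subrr mul0r.
have g1 : g 1 = 1 by rewrite /g divff// subr_eq0.
have := rigid g _ t t2 gdiff ginj g0 g1 gd (mulf_neq0 d0 al0) w.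
move=> /(_ (le_trans wr (le_trans r1 tr))) H; apply: le_lt_trans H _.
have w2 : cabs w <= 2 * rr by have := cabs_supn w; lra.
have w1 : cabs (w - 1) <= 2 * rr + 1.
  by have := ler_cabsB w 1; rewrite cabs1; lra.
rewrite mulrA ltr_pdivrMr; last by lra.
apply: (@le_lt_trans _ _ c).
  rewrite cE; apply: ler_wpM2r; first by lra.
  by apply: ler_pM; rewrite ?cabs_ge0.
have : 2 * c / e <= t - 2 by lra.
rewrite ler_pdivrMr// => H.
have : 0 < e * 1 by rewrite mulr1.
lra.
Qed.

End Charts.

Theorem lemma4p7 (R : realType) (f : sphere R -> sphere R) (d : nat)
    (f_rat : rational_map f d) (d_ge2 : (2 <= d)%N)
    (infty_crit : critical_point f (infty R))
    (z : leaf_space f) (z_aff : affine_part z) :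
  exists alpha beta : nat -> cplx R,
    (forall n, alpha n != 0) /\
    let phi_ n (y : leaf_space f) :=
      similarity (alpha n) (beta n)
        (iter n fhat_inv (orbit_of y) 0%N) in
    exists phi : leaf_space f -> cplx R,
      conformal_iso (leaf_atlas f) (plane_atlas R) (leaf z) [set: cplx R] phi /\
      forall K : set (leaf_space f), compact K -> K `<=` leaf z ->
        (\forall n \near \oo, forall y, K y -> phi_ n y <> infty R) /\
        {uniform K, (fun n y => finite_part (phi_ n y)) @ \oo --> phi}.
Proof.
have [phi phi_iso] := z_aff.
have [psi [[_ psi_leaf] phiK psiK phi_hol psi_hol]] := phi_iso.
pose p n v : cplx R := finite_part (proj psi n v).
(* The first branch is used only for the finitely many [n] for which the
   projection does not separate 0 and 1. *)
pose alpha n := if p n 1 == p n 0 then 1 else (p n 1 - p n 0)^-1.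
exists alpha, (fun n => - (alpha n * p n 0)).
split=> [n|phi_].
  rewrite /alpha; case: (eqVneq (p n 1) (p n 0)) => [_|p10]; first exact: oner_neq0.
  by rewrite invr_eq0 subr_eq0.
exists phi; split=> // K Kc Kz.
have phi_E n y : K y -> phi_ n y =
    similarity (alpha n) (- (alpha n * p n 0)) (proj psi n (phi y)).
  by move=> /Kz zy; rewrite /phi_ iter_fhat_inv /proj phiK.
have [r rP] : exists r : R, forall y, K y -> supn (phi y) <= r.
  have [N _ NP] : \forall N \near \oo, K `<=` fun y => supn (phi y) <= N%:R.
    move/compact_near_coveringP: Kc; apply => y Ky.
    have [phic _] := phi_hol y (Kz y Ky).
    have [N NP] : exists N : nat, supn (phi y) + 1 < N%:R.
      exists (Num.bound (supn (phi y) + 1)); apply: archi_boundP.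
      by rewrite addr_ge0// /supn le_max normr_ge0.
    have near_y : \forall y' \near y, cabs (phi y' - phi y) < 1.
      have : nbhs (phi y) [set v | cabs (v - phi y) < 1].
        by apply/nbhs_cabsP; exists 1.
      exact: phic.
    exists ([set y' | cabs (phi y' - phi y) < 1], [set n | (N <= n)%N]) => /=.
      by split=> //; exists N.
    move=> [y' n] [/= yy' Nn]; rewrite -(subrK (phi y) (phi y')).
    apply: le_trans (supnD _ _) _; have := supn_cabs (phi y' - phi y).
    by have : N%:R <= n%:R :> R; [rewrite ler_nat|lra].
  by exists N%:R => y /(NP N (leqnn N)).
have norm := proj_normalised (fun v => psi_leaf v I) (fun v => psiK v I)
  phi_hol psi_hol infty_crit r.
split.
  apply: filterS (norm 1 ltr01) => n nP y Ky; rewrite phi_E//.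
  by have [+ _] := nP _ (rP y Ky); case: (proj psi n (phi y)).
move=> A /uniform_nbhs[E [entE EA]].
have [e e0 eE] : exists2 e : R, 0 < e & forall a b : cplx R, cabs (b - a) < e -> E (a, b).
  move: entE; rewrite -entourage_ballE => -[e /= e0 eE].
  exists (re e); first by move: e0; rewrite ltcE => /andP[].
  move=> a b ab; apply: eE; rewrite /= /ball/= distrC normE.
  by move: e0 ab; rewrite !ltcE /re /= => /andP[-> _] ->.
apply: filterS (norm e e0) => n nP; apply: EA => y Ky; apply: eE.
have [pf [p10]] := nP _ (rP y Ky); rewrite phi_E//.
rewrite /alpha (negbTE p10) -/(p n 1) -/(p n 0) -/(p n (phi y)).
have -> : finite_part (similarity (p n 1 - p n 0)^-1
    (- ((p n 1 - p n 0)^-1 * p n 0)) (proj psi n (phi y))) =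
    (p n (phi y) - p n 0) / (p n 1 - p n 0).
  by rewrite [p n (phi y)]/p; case: (proj psi n (phi y)) pf => [b|//] _ /=; ring.
by [].
Qed.
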